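(* Let $a=(a_1,a_2,a_3)$ and $b_1,b_2,b_3,b_4$ be complex parameters. The system $\mathcal F\left(\begin{matrix}a\\ B\end{matrix}\right)$, i.e. the left ideal $I$ of the Weyl algebra $W_2=\mathbb C\langle x_1,x_2,\partial_1,\partial_2\rangle$ generated by $$\theta_1(b_1-1+\theta_1)(b_2-1+\theta_1)-x_1\prod_{j=1}^3(a_j+\theta_1+\theta_2),\qquad \theta_2(b_3-1+\theta_2)(b_4-1+\theta_2)-x_2\prod_{j=1}^3(a_j+\theta_1+\theta_2),$$ is of (holonomic) rank $9$. Its singular locus is $$S=\{(x_1,x_2)\in\mathbb C^2\mid x_1x_2R(x_1,x_2)=0\},$$ where, with $\omega=\frac{-1+\sqrt{-3}}2$, $$R(x_1,x_2)=\prod_{k_1,k_2=0}^2\bigl(1-\omega^{k_1}\sqrt[3]{x_1}-\omega^{k_2}\sqrt[3]{x_2}\bigr)=(1-x_1-x_2)^3-27x_1x_2 .$$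
   Context: Here $\partial_i=\partial/\partial x_i$ and $\theta_i=x_i\partial_i$ $(i=1,2)$. The holonomic rank of $I$ is $\dim_{\mathbb C(x_1,x_2)}(\mathcal W_2/\mathcal W_2I)$, where $\mathcal W_2=\mathbb C(x_1,x_2)\langle\partial_1,\partial_2\rangle$. Every element of $W_2$ has a canonical form $\sum c_{i_1,i_2}(x_1,x_2)\partial_1^{i_1}\partial_2^{i_2}$; replacing $\partial_j$ by $\xi_j$ and taking top-degree parts with respect to the weight vector $w=(0,0,1,1)$ on $(x_1,x_2,\partial_1,\partial_2)$ gives the initial ideal $\mathrm{in}_w(I)\subset\mathbb C[x_1,x_2,\xi_1,\xi_2]$. Its zero set in $\mathbb C^4$ is the characteristic variety of $I$. The singular locus of $I$ is the Zariski closure of the image of $V(\mathrm{in}_w(I))\setminus\{(x,\xi)\mid\xi_1=\xi_2=0\}$ under the projection $(x,\xi)\mapsto x\in\mathbb C^2$. *)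

(* Defs.v *)
From HB Require Import structures.
From mathcomp Require Import all_boot all_order all_algebra.
From mathcomp Require Import reals complex ssrcomplements mpoly ring.

Set Implicit Arguments.
Unset Strict Implicit.
Unset Printing Implicit Defensive.

Import GRing.Theory Num.Theory.
Local Open Scope ring_scope.

Definition i1 : 'I_2 := ord0.
Definition i2 : 'I_2 := ord_max.

Lemma ord2P (i : 'I_2) : i = i1 \/ i = i2.
Proof. by case: i => -[|[|//]] h; [left|right]; apply: val_inj. Qed.

Record derivations (A : comNzRingType) := Derivations {
  der :> 'I_2 -> {additive A -> A};
  derM : forall i x y, der i (x * y) = der i x * y + x * der i y;
  der_comm : forall i j x, der i (der j x) = der j (der i x) }.

(** [diffop D] is the free left A-module on the monomials d_1^m1 d_2^m2, with
    the product for which d_i a = a d_i + D_i(a).  An operator is represented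
    by its canonical form, i.e. the polynomial obtained from it by writing all
    coefficients on the left and replacing each d_j by a variable xi_j. *)
Definition diffop (A : comNzRingType) (D : derivations A) : Type :=
  {mpoly A[2]}.

HB.instance Definition _ (A : comNzRingType) (D : derivations A) :=
  GRing.Lmodule.copy (diffop D) {mpoly A[2]}.

Definition canform (A : comNzRingType) (D : derivations A) (P : diffop D) :
  {mpoly A[2]} := P.

Definition ofcanform (A : comNzRingType) (D : derivations A)
  (p : {mpoly A[2]}) : diffop D := p.

Section DiffOp.
Variables (A : comNzRingType) (D : derivations A).
Implicit Types (p q r : {mpoly A[2]}) (m : 'X_{1..2}).

(** Left multiplication by d_i on canonical forms:
    d_i (sum_m q_m d^m) = sum_m q_m d_i d^m + sum_m D_i(q_m) d^m. *)
Definition dlmul (i : 'I_2) q : {mpoly A[2]} := 'X_i * q + map_mpoly (D i) q.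

Definition dlmulm m q : {mpoly A[2]} :=
  iter (m i1) (dlmul i1) (iter (m i2) (dlmul i2) q).

Definition dmul p q : {mpoly A[2]} := \sum_(m <- msupp p) p@_m *: dlmulm m q.

Lemma der1 i : D i 1 = 0.
Proof.
have := derM D i 1 1; rewrite !mulr1 mul1r => /eqP.
by rewrite -subr_eq0 opprD addNKr oppr_eq0 => /eqP.
Qed.

Lemma dlmulD i : {morph dlmul i : p q / p + q}.
Proof. by move=> p q; rewrite /dlmul mulrDr raddfD addrACA. Qed.

Lemma dlmul0 i : dlmul i 0 = 0.
Proof. by rewrite /dlmul mulr0 raddf0 addr0. Qed.

Lemma dlmulZ i (c : A) p : dlmul i (c *: p) = c *: dlmul i p + D i c *: p.
Proof.
rewrite /dlmul scalerDr scalerAr -addrA; congr (_ + _).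
apply/mpolyP => m; rewrite mcoeffD !mcoeffZ !mcoeff_map_mpoly /= mcoeffZ.
by rewrite derM addrC.
Qed.

Lemma dlmulX i m : dlmul i 'X_[m] = 'X_[(U_(i) + m)].
Proof.
rewrite /dlmul mpolyXD; apply/eqP; rewrite addrC -subr_eq0 addrK.
apply/eqP/mpolyP => k; rewrite mcoeff_map_mpoly /= mcoeffX mcoeff0.
by case: eqP => _; rewrite ?der1 // raddf0.
Qed.

Lemma dlmul_comm i j p : dlmul i (dlmul j p) = dlmul j (dlmul i p).
Proof.
have mapX k l q : map_mpoly (D k) ('X_l * q) = 'X_l * map_mpoly (D k) q.
  elim/mpolyind: q => [|c m q _ _ IH].
    by rewrite mulr0 raddf0 mulr0.
  rewrite mulrDr !raddfD /= mulrDr IH; congr (_ + _).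
  rewrite -scalerAr -mpolyXD; apply/mpolyP => u.
  rewrite mcoeff_map_mpoly /= mcoeffZ.
  have -> : map_mpoly (D k) (c *: 'X_[m]) = D k c *: 'X_[m].
    apply/mpolyP => v; rewrite mcoeff_map_mpoly /= !mcoeffZ mcoeffX.
    by case: eqP => _; rewrite ?mulr1 // !mulr0 raddf0.
  rewrite -scalerAr -mpolyXD mcoeffZ !mcoeffX.
  by case: eqP => _; rewrite ?mulr1 // !mulr0 raddf0.
rewrite /dlmul !mulrDr !raddfD /= !mapX.
rewrite [in RHS]mulrCA -!addrA; congr (_ + _).
rewrite addrCA; congr (_ + (_ + _)).
by apply/mpolyP => m; rewrite !mcoeff_map_mpoly /= der_comm.
Qed.

Lemma dlmulmD m : {morph dlmulm m : p q / p + q}.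
Proof.
have iterD i n : {morph iter n (dlmul i) : p q / p + q}.
  by elim: n => [//|n IH] p q; rewrite !iterS (IH p q) dlmulD.
by move=> p q; rewrite /dlmulm !iterD.
Qed.

Lemma dlmulm0 m : dlmulm m 0 = 0.
Proof. by apply: (@addrI _ (dlmulm m 0)); rewrite -dlmulmD !addr0. Qed.

Lemma iter_dlmul i j n p :
  dlmul i (iter n (dlmul j) p) = iter n (dlmul j) (dlmul i p).
Proof. by elim: n => //= n <-; rewrite dlmul_comm. Qed.

Lemma dlmulmU i m p : dlmulm (U_(i) + m) p = dlmul i (dlmulm m p).
Proof.
rewrite /dlmulm !mnmDE !mnm1E.
case: (ord2P i) => ->.
  by rewrite eqxx /= !add0n.
by rewrite eqxx /= !add0n -iter_dlmul.
Qed.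

Lemma dmulwE k p q : (msize p <= k)%N ->
  dmul p q = \sum_(m : 'X_{1..2 < k}) p@_m *: dlmulm m q.
Proof.
move=> le_pk; pose I : subFinType _ := 'X_{1..2 < k}.
rewrite /dmul (big_mksub I) //=; first last.
- by move=> x /msize_mdeg_lt /leq_trans /(_ le_pk) ->.
- by rewrite msupp_uniq.
by rewrite big_rmcond //= => m /memN_msupp_eq0 ->; rewrite scale0r.
Qed.

Lemma dmulDl : left_distributive dmul +%R.
Proof.
move=> p q r; pose k := maxn (msize (p + q)) (maxn (msize p) (msize q)).
rewrite !(@dmulwE k) ?leq_max ?leqnn ?orbT // -big_split /=.
by apply: eq_bigr => m _; rewrite mcoeffD scalerDl.
Qed.

Lemma dmulDr : right_distributive dmul +%R.
Proof.
move=> p q r; rewrite /dmul -big_split /=.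
by apply: eq_bigr => m _; rewrite dlmulmD scalerDr.
Qed.

Lemma dmul0l q : dmul 0 q = 0.
Proof. by rewrite /dmul msupp0 big_nil. Qed.

Lemma dmulZl (c : A) p q : dmul (c *: p) q = c *: dmul p q.
Proof.
pose k := maxn (msize (c *: p)) (msize p).
rewrite !(@dmulwE k) ?leq_max ?leqnn ?orbT // scaler_sumr.
by apply: eq_bigr => m _; rewrite mcoeffZ scalerA.
Qed.

Lemma dmulX m q : dmul 'X_[m] q = dlmulm m q.
Proof. by rewrite /dmul msuppX big_seq1 mcoeffX eqxx scale1r. Qed.

Lemma dmul1l : left_id 1 dmul.
Proof. by move=> q; rewrite -mpolyX0 dmulX /dlmulm !mnm0E. Qed.

Lemma dlmulm1 m : dlmulm m 1 = 'X_[m].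
Proof.
rewrite /dlmulm -mpolyX0.
have iterX i n u : iter n (dlmul i) 'X_[u] = 'X_[(U_(i) *+ n + u)].
  elim: n => [|n IH] /=; first by rewrite mulm0n add0m.
  by rewrite IH dlmulX mulmS addmA.
rewrite !iterX addm0; congr 'X_[_]; apply/mnmP => i.
rewrite mnmDE !mulmnE !mnm1E.
by case: (ord2P i) => ->; rewrite eqxx /= mul1n mul0n ?addn0.
Qed.

Lemma dmul1r : right_id 1 dmul.
Proof.
move=> p; rewrite /dmul [RHS]mpolyE.
by apply: eq_bigr => m _; rewrite dlmulm1.
Qed.

Lemma dmul_dlmul i p q : dmul (dlmul i p) q = dlmul i (dmul p q).
Proof.
elim/mpolyind: p => [|c m p _ _ IH].
  by rewrite dlmul0 !dmul0l dlmul0.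
rewrite dlmulD [LHS]dmulDl [dmul (_ + p) q]dmulDl dlmulD IH; congr (_ + _).
by rewrite dlmulZ [LHS]dmulDl !dmulZl dlmulX !dmulX dlmulmU dlmulZ.
Qed.

Lemma dmulA : associative dmul.
Proof.
move=> p q r; elim/mpolyind: p => [|c m p _ _ IH]; first by rewrite !dmul0l.
rewrite !dmulDl IH; congr (_ + _); rewrite !dmulZl; congr (_ *: _).
rewrite !dmulX /dlmulm.
have iter_dmul i n u : dmul (iter n (dlmul i) u) r = iter n (dlmul i) (dmul u r).
  by elim: n => //= n <-; rewrite dmul_dlmul.
by rewrite !iter_dmul.
Qed.

HB.instance Definition _ := GRing.Zmodule_isNzRing.Build (diffop D)
  dmulA dmul1l dmul1r dmulDl dmulDr (oner_neq0 {mpoly A[2]}).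

HB.instance Definition _ := GRing.Lmodule_isLalgebra.Build A (diffop D)
  (fun c p q => esym (dmulZl c p q)).

Definition partial (i : 'I_2) : diffop D := 'X_i.

Lemma partial_scale i (c : A) (P : diffop D) :
  partial i * (c *: P) = c *: (partial i * P) + D i c *: P.
Proof.
have E (Q : diffop D) : partial i * Q = dlmul i Q.
  have -> : partial i * Q = dlmulm (U_(i) + 0) Q by rewrite addm0 -dmulX.
  by rewrite dlmulmU /dlmulm !mnm0E.
by rewrite !E dlmulZ.
Qed.

Lemma canonical_formE (P : diffop D) :
  P = \sum_(m <- msupp (canform P))
        (canform P)@_m *: (partial i1 ^+ m i1 * partial i2 ^+ m i2).
Proof.
rewrite [LHS](mpolyE (canform P)); apply: eq_bigr => m _; congr (_ *: _).
have E i (Q : diffop D) n : partial i ^+ n * Q = iter n (dlmul i) Q.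
  elim: n => [|n IH]; first by rewrite mul1r.
  rewrite exprS -mulrA IH /=.
  have -> R : partial i * R = dlmulm (U_(i) + 0) R by rewrite addm0 -dmulX.
  by rewrite dlmulmU /dlmulm !mnm0E.
by rewrite -[partial i2 ^+ _]mulr1 !E -dlmulm1.
Qed.

End DiffOp.

Section PolyDerivations.
Variable C : fieldType.

Definition poly_der : derivations {mpoly C[2]} :=
  @Derivations {mpoly C[2]} (fun i => @mderiv 2 C i)
    (@mderivM 2 C) (fun i j => @mderiv_comm 2 C j i).

End PolyDerivations.

Section FracDerivation.
Variable A : idomainType.
Local Notation "x %:F" := (@FracField.tofrac A x).

(** The quotient rule, applied to a chosen representative; see [fracderE]. *)
Definition fracder (d : A -> A) (x : {fraction A}) : {fraction A} :=
  let n := (frac (repr x)).1 in let m := (frac (repr x)).2 in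
  (d n * m - n * d m)%:F / (m ^+ 2)%:F.

Lemma fracE (x : {fraction A}) :
  x = (frac (repr x)).1%:F / (frac (repr x)).2%:F.
Proof.
have nz := denom_ratioP (repr x).
apply: (@mulIf _ (frac (repr x)).2%:F); first by rewrite tofrac_eq0.
rewrite divfK ?tofrac_eq0 // -{1}[x]reprK.
set r := repr x in nz *; unlock FracField.tofrac.
rewrite -[LHS]FracField.pi_mul; apply/eqmodP; rewrite /= FracField.equivfE.
rewrite /FracField.mulf !numden_Ratio ?mulr1 ?oner_neq0 //.
by rewrite mulrC.
Qed.

Variables (d : {additive A -> A}).
Hypothesis dM : forall x y, d (x * y) = d x * y + x * d y.

Lemma fracderE p q : q != 0 ->
  fracder d (p%:F / q%:F) = (d p * q - p * d q)%:F / (q ^+ 2)%:F.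
Proof.
move=> q0; rewrite /fracder; set x := p%:F / q%:F.
have := denom_ratioP (repr x); have := fracE x.
move: (frac _).1 (frac _).2 => n m /eqP + m0.
rewrite /x eqr_div ?tofrac_eq0 // -!tofracM tofrac_eq => /eqP pm.
apply/eqP; rewrite eqr_div ?tofrac_eq0 ?expf_neq0 // -!tofracM tofrac_eq.
have := congr1 d pm; rewrite !dM => dpm.
apply/eqP.
have -> : (d n * m - n * d m) * q ^+ 2 =
  m * q * (d n * q + n * d q) - q * d m * (n * q) - m * d q * (n * q) by ring.
rewrite -dpm -pm; ring.
Qed.

Lemma fracderD : {morph fracder d : x y / x + y}.
Proof.
move=> x y; rewrite [x]fracE [y]fracE.
have := denom_ratioP (repr x); have := denom_ratioP (repr y).
move: (frac _).1 (frac _).2 (frac _).1 (frac _).2 => p q n m q0 m0.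
rewrite addf_div ?tofrac_eq0 // -!tofracM -tofracD !fracderE ?mulf_neq0 //.
rewrite addf_div ?tofrac_eq0 ?expf_neq0 // -!tofracM -tofracD.
apply/eqP; rewrite eqr_div ?tofrac_eq0 ?(mulf_neq0, expf_neq0) //.
rewrite -!tofracM tofrac_eq; apply/eqP; rewrite raddfD /= !dM; ring.
Qed.

Lemma fracderM x y : fracder d (x * y) = fracder d x * y + x * fracder d y.
Proof.
rewrite [x]fracE [y]fracE.
have := denom_ratioP (repr x); have := denom_ratioP (repr y).
move: (frac _).1 (frac _).2 (frac _).1 (frac _).2 => p q n m q0 m0.
rewrite mulf_div -!tofracM !fracderE ?mulf_neq0 //.
rewrite !mulf_div -!tofracM addf_div ?tofrac_eq0 ?(mulf_neq0, expf_neq0) //.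
rewrite -!tofracM -tofracD.
apply/eqP; rewrite eqr_div ?tofrac_eq0 ?(mulf_neq0, expf_neq0) //.
rewrite -!tofracM tofrac_eq; apply/eqP; rewrite !dM; ring.
Qed.

End FracDerivation.

Section RatDerivations.
Variable C : fieldType.
Local Notation "x %:F" := (@FracField.tofrac {mpoly C[2]} x).

Definition ratfun : fieldType := {fraction {mpoly C[2]}}.

Definition ratder (i : 'I_2) (x : ratfun) : ratfun :=
  fracder (@mderiv 2 C i) x.

Lemma ratder_is_zmod_morphism i : zmod_morphism (ratder i).
Proof.
have D := fracderD (d := mderiv i) (@mderivM 2 C i).
move=> x y; apply/eqP; rewrite eq_sym subr_eq; apply/eqP.
by rewrite -[RHS]D subrK.
Qed.

HB.instance Definition _ i := GRing.isZmodMorphism.Build ratfun ratfun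
  (ratder i) (ratder_is_zmod_morphism i).

Lemma ratder_comm i j x : ratder i (ratder j x) = ratder j (ratder i x).
Proof.
rewrite [x]fracE; have := denom_ratioP (repr x).
move: (frac _).1 (frac _).2 => p q q0.
have DE k u v : v != 0 -> ratder k (u%:F / v%:F) =
    (mderiv k u * v - u * mderiv k v)%:F / (v ^+ 2)%:F.
  exact: (fracderE (@mderivM 2 C k)).
rewrite !DE ?expf_neq0 //.
apply/eqP; rewrite eqr_div ?tofrac_eq0 ?expf_neq0 // -!tofracM tofrac_eq.
rewrite !expr2 !mderivB !mderivM (mderiv_comm i j p) (mderiv_comm i j q).
apply/eqP; ring.
Qed.

Lemma ratder_tofrac i (p : {mpoly C[2]}) : ratder i p%:F = (mderiv i p)%:F.
Proof.
have /= := fracderE (@mderivM 2 C i) p (oner_neq0 {mpoly C[2]}).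
rewrite (der1 (poly_der C) i : mderiv i 1 = 0) mulr0 subr0 mulr1 expr1n.
by rewrite tofrac1 !divr1.
Qed.

Definition rat_der : derivations ratfun :=
  @Derivations ratfun (fun i => ratder i)
    (fun i => fracderM (@mderivM 2 C i)) ratder_comm.

End RatDerivations.

(** W_2 = C<x_1, x_2, d_1, d_2>. *)
Notation weyl C := (diffop (poly_der C)).

(** C(x_1, x_2)<d_1, d_2>. *)
Notation ratweyl C := (diffop (rat_der C)).

Section Weyl.
Variable C : fieldType.

Definition weyl_to_rat (P : weyl C) : ratweyl C :=
  ofcanform _ (map_mpoly (@FracField.tofrac {mpoly C[2]}) (canform P)).

Definition xvar (i : 'I_2) : weyl C := ('X_i : {mpoly C[2]})%:A.

Lemma partial_xvar i j :
  partial _ i * xvar j = xvar j * partial _ i + (i == j)%:R.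
Proof.
rewrite /xvar partial_scale mulr1 -scalerAl mul1r; congr (_ + _).
rewrite /= mderivX mnm1E eq_sym; case: eqP => [->|_]; last first.
  by rewrite !scale0r.
have -> : (U_(j) - U_(j) = 0)%MM by apply/mnmP => k; rewrite mnmBE subnn mnm0E.
by rewrite mpolyX0 !scale1r.
Qed.

Definition theta (i : 'I_2) : weyl C := xvar i * partial _ i.

Definition wconst (c : C) : weyl C := (c%:MP_[2])%:A.

End Weyl.

Definition left_ideal (T : nzRingType) (S : T -> Prop) (x : T) : Prop :=
  exists n (u s : 'I_n -> T),
    (forall k, S (s k)) /\ x = \sum_(k < n) u k * s k.

(** dim (V / J) = n, for a subspace [J] of [V]: the classes of some v_1, ..., v_n
    form a basis of V / J. *)
Definition quotient_dim (K : fieldType) (V : lmodType K) (J : V -> Prop)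
    (n : nat) : Prop :=
  exists v : 'I_n -> V, forall x : V,
    exists! c : 'rV[K]_n, J (x - \sum_(k < n) c 0 k *: v k).

Section Locus.
Variable C : fieldType.
Implicit Types (I : weyl C -> Prop) (x xi : 'I_2 -> C).

Definition holonomic_rank I (r : nat) : Prop :=
  quotient_dim
    (left_ideal (fun Q : ratweyl C => exists2 P, I P & Q = weyl_to_rat P)) r.

(** C[x_1, x_2, xi_1, xi_2] is realized as C[x_1, x_2][xi_1, xi_2], so that the
    w-degree is the total degree in the outer variables ([msize] is the degree
    plus one). *)
Definition initial_form (P : weyl C) : {mpoly {mpoly C[2]}[2]} :=
  pihomog mdeg (msize (canform P)).-1 (canform P).

Definition initial_ideal I : {mpoly {mpoly C[2]}[2]} -> Prop :=
  left_ideal (fun f => exists2 P, I P & f = initial_form P).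

Definition char_variety I x xi : Prop :=
  forall f, initial_ideal I f -> (map_mpoly (meval x) f).@[xi] = 0.

Definition zariski_closed (Z : ('I_2 -> C) -> Prop) : Prop :=
  exists F : {mpoly C[2]} -> Prop,
    forall x, Z x <-> (forall f, F f -> f.@[x] = 0).

Definition zariski_closure (Y : ('I_2 -> C) -> Prop) x : Prop :=
  forall Z, zariski_closed Z -> (forall y, Y y -> Z y) -> Z x.

Definition singular_locus I : ('I_2 -> C) -> Prop :=
  zariski_closure (fun x =>
    exists2 xi, char_variety I x xi & ~ (xi i1 = 0 /\ xi i2 = 0)).

Definition hg_op (a : 'I_3 -> C) (b b' : C) (i : 'I_2) : weyl C :=
  theta C i * (wconst b - 1 + theta C i) * (wconst b' - 1 + theta C i)
  - xvar C i * \prod_(j < 3) (wconst (a j) + theta C i1 + theta C i2).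

Definition hg_ideal (a : 'I_3 -> C) (b1 b2 b3 b4 : C) : weyl C -> Prop :=
  left_ideal (fun P => P = hg_op a b1 b2 i1 \/ P = hg_op a b3 b4 i2).

Definition hg_disc (x1 x2 : C) : C :=
  (1 - x1 - x2) ^+ 3 - 27%:R * x1 * x2.

End Locus.

(* Main.v *)
Require Import Defs.
From HB Require Import structures.
From mathcomp Require Import all_boot all_order all_algebra.
From mathcomp Require Import reals complex mpoly.
From mathcomp Require Import zify ring.

(** Write P_1, P_2 for the two generators, y_i = x_i xi_i and s = y_1 + y_2.
    The principal symbol of P_i is the cubic form f_i = y_i^3 - x_i s^3 in
    xi_1, xi_2 ([principal_hg_op]), and everything follows from two facts.

    The operators commute ([hypergeometric_commute]): every term of P_i is a
    polynomial in the Euler operators, possibly preceded by x_i, and moving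
    x_1 or x_2 through E = prod_j (a_j + theta_1 + theta_2) shifts E by the same
    amount.

    The forms f_1, f_2 are a regular sequence, over C[x_1, x_2] and over
    C(x_1, x_2) ([poly_regular], [field_regular]).  Modulo (f_1, f_2) one has
    e s^3 = 3 y_1 y_2 s with e = 1 - x_1 - x_2, and the multiples of this
    relation in degree 5 form a 3 x 3 linear system with determinant
    disc = e^3 - 27 x_1 x_2; so disc annihilates the forms of degree 5 modulo
    (f_1, f_2), which excludes common factors of f_1 and f_2 other than
    constants in xi.  The constants are handled by divisibility in C[x_1, x_2].

    Consequently, if the leading terms of U P_1 + V P_2 cancel, they do so by a
    multiple of the trivial relation f_2 f_1 - f_1 f_2 = 0, which lifts to
    P_2 P_1 - P_1 P_2 = 0; subtracting the lift lowers the orders of U and V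
    ([reduction]).  This has two applications.

    Over C[x_1, x_2] it shows that the initial ideal is generated by f_1 and
    f_2 for all values of the parameters, so the characteristic variety is the
    common zero set of f_1 and f_2 ([char_varietyP]).  A point with x_1 x_2 != 0
    and xi != 0 lies on it exactly when the t_i = y_i / s are cube roots of the
    x_i with t_1 + t_2 = 1, that is, when disc = 0; over x_i = 0 the i-th
    coordinate direction lies on it ([singular_point_iff]).

    Over C(x_1, x_2) it gives the rank: the operators d_1^i d_2^j with
    i, j <= 2 form a basis of the quotient.  They span, since every form is
    congruent to a combination of y_1^i y_2^j with i, j <= 2 modulo (f_1, f_2)
    ([forms_spanned]); they are independent, since no nonzero combination of
    these nine monomials in a single degree lies in (f_1, f_2)
    ([reduced_ideal_eq0]). *)

Set Implicit Arguments.
Unset Strict Implicit.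
Unset Printing Implicit Defensive.

Import GRing.Theory Num.Theory.
Local Open Scope ring_scope.

(** * Degrees of polynomials in two variables *)

Section Size.
Variables (n : nat) (A : nzRingType).
Implicit Types p q : {mpoly A[n]}.

Lemma msizeP p k : reflect (forall m, (k <= mdeg m)%N -> p@_m = 0) (msize p <= k)%N.
Proof.
apply: (iffP idP) => [le_pk m le_km|H].
  by apply/memN_msupp_eq0/msize_mdeg_ge/(leq_trans le_pk).
rewrite msizeE; apply/bigmax_leqP_seq => m pm _; rewrite ltnNge.
by apply/negP => /H /eqP; rewrite mcoeff_eq0 pm.
Qed.

Lemma msizeD_leq k p q :
  (msize p <= k -> msize q <= k -> msize (p + q) <= k)%N.
Proof. by move=> hp hq; rewrite (leq_trans (msizeD_le _ _)) // geq_max hp. Qed.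

Lemma msizeB_leq k p q :
  (msize p <= k -> msize q <= k -> msize (p - q) <= k)%N.
Proof. by move=> hp hq; apply: msizeD_leq => //; rewrite mmeasureN. Qed.

Lemma dhomog_msize_leq k p : p \is k.-homog -> (msize p <= k.+1)%N.
Proof.
move=> hp; apply/msizeP => m hm; apply: (dhomog_nemf_coeff hp).
by rewrite gtn_eqF.
Qed.

Lemma pihomog_small k p : (msize p <= k)%N -> pihomog mdeg k p = 0.
Proof.
move=> hp; rewrite /pihomog big_seq_cond big1 // => m /andP[mp /eqP dm].
by have := leq_trans (msize_mdeg_lt mp) hp; rewrite dm ltnn.
Qed.

Lemma mcoeff_pihomog k p m :
  (pihomog mdeg k p)@_m = if mdeg m == k then p@_m else 0.
Proof.
have [dm|dm] := eqVneq (mdeg m) k; last first.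
  by apply: (dhomog_nemf_coeff (pihomogP mdeg k p)).
rewrite (@pihomogwE n A mdeg k (maxn (msize p) k.+1)) ?leq_maxl //.
rewrite raddf_sum /=.
have lt : (mdeg m < maxn (msize p) k.+1)%N by rewrite leq_max dm ltnSn orbT.
rewrite (bigD1 (BMultinom lt)) /= ?dm // big1 ?addr0 => [|i /andP[_ ne]].
  by rewrite mcoeffZ mcoeffX eqxx mulr1.
rewrite mcoeffZ mcoeffX; case: eqP => [e|]; last by rewrite mulr0.
by case/eqP: ne; apply/val_inj.
Qed.

Lemma msize_pihomogB k p :
  (msize p <= k.+1)%N -> (msize (p - pihomog mdeg k p) <= k)%N.
Proof.
move=> /msizeP hp; apply/msizeP => m hm; rewrite mcoeffB mcoeff_pihomog.
have [_|ne] := eqVneq (mdeg m) k; first by rewrite subrr.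
by rewrite subr0 hp // ltn_neqAle eq_sym ne.
Qed.

End Size.

Definition mnm2 j k : 'X_{1..2} := (U_(i1) *+ j + U_(i2) *+ k)%MM.

Lemma mnm2_1 j k : mnm2 j k i1 = j.
Proof. by rewrite mnmDE !mulmnE !mnm1E eqxx /= mul1n mul0n addn0. Qed.

Lemma mnm2_2 j k : mnm2 j k i2 = k.
Proof. by rewrite mnmDE !mulmnE !mnm1E eqxx /= mul1n mul0n. Qed.

Lemma mnm2E (m : 'X_{1..2}) : mnm2 (m i1) (m i2) = m.
Proof. by apply/mnmP => i; case: (ord2P i) => ->; rewrite ?mnm2_1 ?mnm2_2. Qed.

Section BinaryMonomials.
Variable A : nzRingType.

Lemma mdeg2 (m : 'X_{1..2}) : mdeg m = (m i1 + m i2)%N.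
Proof.
by rewrite mdegE big_ord_recr big_ord1 /=; congr (m _ + m _)%N; apply: val_inj.
Qed.

Lemma mpolyX2 (m : 'X_{1..2}) : 'X_[m] = 'X_i1 ^+ m i1 * 'X_i2 ^+ m i2 :> {mpoly A[2]}.
Proof.
rewrite mpolyXE_id big_ord_recr big_ord1 /=.
by congr ('X_ _ ^+ m _ * 'X_ _ ^+ m _); apply: val_inj.
Qed.

Lemma dhomogC (c : A) : c%:MP_[2] \is 0.-homog.
Proof. by rewrite -[_%:MP]mulr1 mul_mpolyC dhomogZ // dhomog1. Qed.

End BinaryMonomials.

(** * Principal parts of differential operators *)

Section Symbol.
Variables (A : comNzRingType) (D : derivations A).
Implicit Types (P Q : diffop D) (p q : {mpoly A[2]}).

(** The form p may be 0, in which case Q has order less than k.  This makes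
    principal parts of a prescribed order additive; since [msize] is the degree
    plus one, the bound says that Q - p has order less than k. *)
Definition principal k Q p :=
  p \is k.-homog /\ (msize (canform Q - p) <= k)%N.

Lemma msizeM_leq j k (p q : {mpoly A[2]}) :
  (msize p <= j.+1 -> msize q <= k -> msize (p * q) <= j + k)%N.
Proof.
move=> /msizeP hp /msizeP hq; apply/msizeP => m hm.
rewrite mcoeffM big1 // => -[a b] /= /eqP e.
have [/hp->|la] := leqP j.+1 (mdeg a); first by rewrite mul0r.
have := congr1 mdeg e; rewrite mdegD => dm.
rewrite (hq b) ?mulr0 // -(leq_add2l j) (leq_trans hm) //.
by rewrite (leq_trans (eq_leq dm)) // leq_add2r.
Qed.

Lemma msize_dlmul i k (q : {mpoly A[2]}) :
  (msize q <= k)%N -> (msize (dlmul D i q - 'X_i * q) <= k)%N.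
Proof.
move=> /msizeP hq; rewrite /dlmul addrC addKr; apply/msizeP => m hm.
by rewrite mcoeff_map_mpoly /= hq // raddf0.
Qed.

Lemma msize_dlmulm m k (q : {mpoly A[2]}) : (msize q <= k.+1)%N ->
  (msize (dlmulm D m q - 'X_[m] * q) <= mdeg m + k)%N.
Proof.
have U i j n (r s : {mpoly A[2]}) :
    (msize s <= j.+1 -> msize (r - s) <= j ->
     msize (iter n (dlmul D i) r - 'X_i ^+ n * s) <= n + j)%N.
  move=> hs hr; elim: n => [|n IH] /=; first by rewrite mul1r.
  set z := iter _ _ _ in IH *; set t := 'X_i ^+ n * s in IH *.
  have ht : (msize t <= (n + j).+1)%N.
    rewrite -addnS; apply: msizeM_leq => //.
    by rewrite mpolyXn msizeX mdegMn mdeg1 mul1n.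
  have hz : (msize z <= (n + j).+1)%N.
    by rewrite -(subrK t z); apply: msizeD_leq => //; apply: leqW.
  have -> : dlmul D i z - 'X_i ^+ n.+1 * s =
     (dlmul D i z - 'X_i * z) + 'X_i * (z - t) by rewrite /t exprS; ring.
  apply: msizeD_leq; first exact: msize_dlmul.
  by apply: (msizeM_leq (j := 1)) => //; rewrite msizeX mdeg1.
move=> hq; rewrite /dlmulm.
rewrite (mpolyX2 A m) -mulrA mdeg2 -addnA; apply: (U); last first.
  by apply: (U); rewrite // subrr msize0.
rewrite -addnS; apply: msizeM_leq => //.
by rewrite mpolyXn msizeX mdegMn mdeg1 mul1n.
Qed.

(** Moving d_i past a coefficient produces an extra term of lower order, so up to
    lower order operators compose like their canonical forms. *)
Lemma msize_dmul j k (p q : {mpoly A[2]}) :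
  (msize p <= j.+1 -> msize q <= k.+1 ->
   msize (dmul D p q - p * q) <= j + k)%N.
Proof.
move=> hp hq.
have -> : dmul D p q - p * q =
    \sum_(m <- msupp p) p@_m *: (dlmulm D m q - 'X_[m] * q).
  have -> : p * q = \sum_(m <- msupp p) p@_m *: ('X_[m] * q).
    by rewrite {1}(mpolyE p) mulr_suml; apply: eq_bigr => m _; rewrite scalerAl.
  by rewrite -sumrB; apply: eq_bigr => m _; rewrite scalerBr.
rewrite big_seq_cond; apply: (big_ind (fun r => msize r <= j + k)%N).
- by rewrite msize0.
- by move=> ? ?; apply: msizeD_leq.
move=> m /andP[pm _]; apply: leq_trans (msizeZ_le _ _) _.
apply: leq_trans (msize_dlmulm m hq) _; rewrite leq_add2r.
by have := leq_trans (msize_mdeg_lt pm) hp.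
Qed.

Lemma principal_msize k Q p : principal k Q p -> (msize (canform Q) <= k.+1)%N.
Proof.
move=> [hp hQ]; rewrite -(subrK p (canform Q)); apply: msizeD_leq.
  exact: leqW.
exact: dhomog_msize_leq.
Qed.

Lemma principal_pihomog k Q p : principal k Q p -> pihomog mdeg k (canform Q) = p.
Proof.
move=> [hp hQ]; rewrite -(subrK p (canform Q)) raddfD /=.
by rewrite pihomog_small // add0r pihomog_dE.
Qed.

Lemma pihomog_principal k Q :
  (msize (canform Q) <= k.+1)%N -> principal k Q (pihomog mdeg k (canform Q)).
Proof. by move=> hQ; split; [apply: pihomogP | apply: msize_pihomogB]. Qed.

Lemma principalM j k P Q p q :
  principal j P p -> principal k Q q -> principal (j + k) (P * Q) (p * q).
Proof.
move=> hP hQ; have [[hp hPp] [hq hQq]] := (hP, hQ).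
split; first exact: dhomogM.
have -> : canform (P * Q) - p * q = (dmul D P Q - canform P * canform Q)
   + ((canform P - p) * canform Q + p * (canform Q - q)).
  rewrite -[canform (P * Q)]/(dmul D P Q).
  by move: (dmul _ _ _) (canform P) (canform Q) => u v w; ring.
apply: msizeD_leq.
  by apply: msize_dmul; apply: principal_msize; [apply: hP | apply: hQ].
apply: msizeD_leq; last by apply: msizeM_leq => //; apply: dhomog_msize_leq.
rewrite mulrC addnC; apply: msizeM_leq => //; exact: principal_msize hQ.
Qed.

Lemma principal_prod n k (P : 'I_n -> diffop D) p :
  (forall j, principal k (P j) p) -> principal (n * k) (\prod_(j < n) P j) (p ^+ n).
Proof.
elim: n P => [|n IH] P hP; last first.
  by rewrite big_ord_recl exprS mulSn; apply: principalM => //; apply: IH.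
rewrite big_ord0 expr0 mul0n; split; first exact: dhomog1.
by rewrite [canform _ - _]subrr msize0.
Qed.

Lemma principalD k P Q p q :
  principal k P p -> principal k Q q -> principal k (P + Q) (p + q).
Proof.
move=> [hp hPp] [hq hQq]; split; first exact: dhomogD.
by rewrite opprD addrACA; apply: msizeD_leq.
Qed.

Lemma principalN k P p : principal k P p -> principal k (- P) (- p).
Proof.
move=> [hp hPp]; split; first by rewrite dhomogN.
by rewrite -opprD mmeasureN.
Qed.

Lemma principal0 k P : (msize (canform P) <= k)%N -> principal k P 0.
Proof. by move=> h; split; rewrite ?dhomog0 ?subr0. Qed.

Lemma principal_scale c : principal 0 (c%:A : diffop D) c%:MP.
Proof.
have e : canform (c%:A : diffop D) = c%:MP by rewrite -[RHS]mulr1 mul_mpolyC.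
split; first exact: dhomogC.
by rewrite e subrr msize0.
Qed.

Lemma principal_partial i : principal 1 (partial D i) 'X_i.
Proof.
split; first by rewrite dhomogX /= mdeg1.
by rewrite (_ : canform _ = 'X_i) // subrr msize0.
Qed.

End Symbol.

(** * Left ideals with two generators *)

Section LeftIdeal.
Variable T : nzRingType.
Implicit Types (S : T -> Prop).

Lemma left_ideal_gen S x : S x -> left_ideal S x.
Proof.
move=> Sx; exists 1, (fun=> 1), (fun=> x).
by split=> //; rewrite big_ord1 mul1r.
Qed.

Lemma left_ideal_sub S (J : T -> Prop) :
  J 0 -> (forall x y, J x -> J y -> J (x + y)) -> (forall u s, S s -> J (u * s)) ->
  forall x, left_ideal S x -> J x.
Proof.
move=> J0 JD JM x [n [u [s [Ss ->]]]].
by apply: (big_ind J) => // k _; apply: JM.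
Qed.

Lemma left_ideal2 S (P1 P2 u1 u2 : T) :
  S P1 -> S P2 -> left_ideal S (u1 * P1 + u2 * P2).
Proof.
move=> S1 S2.
exists 2, (fun k => if k == 0 then u1 else u2), (fun k => if k == 0 then P1 else P2).
split; first by move=> k; case: ifP.
by rewrite big_ord_recr big_ord1.
Qed.

Lemma left_ideal_pair (P1 P2 x : T) :
  left_ideal (fun P => P = P1 \/ P = P2) x <->
  exists u1 u2, x = u1 * P1 + u2 * P2.
Proof.
split=> [|[u1 [u2 ->]]]; last by apply: left_ideal2; [left | right].
apply: (left_ideal_sub (J := fun x => exists u1 u2, x = u1 * P1 + u2 * P2))
  => [|y z [u1 [u2 ->]] [v1 [v2 ->]]|u s [->|->]].
- by exists 0, 0; rewrite !mul0r addr0.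
- by exists (u1 + v1), (u2 + v2); rewrite !mulrDl addrACA.
- by exists u, 0; rewrite mul0r addr0.
- by exists 0, u; rewrite mul0r add0r.
Qed.

Lemma rmorph_combination0 (S : nzRingType) (f : {rmorphism T -> S}) w u v p q :
  f p = 0 -> f q = 0 -> f (w * (u * p + v * q)) = 0.
Proof. by move=> p0 q0; rewrite rmorphM rmorphD !rmorphM p0 q0 !mulr0 addr0 mulr0. Qed.

End LeftIdeal.

Lemma left_ideal_map (T S : nzRingType) (g : T -> S) (P1 P2 : T) (x : S) :
  {morph g : P Q / P + Q} -> {morph g : P Q / P * Q} ->
  left_ideal (fun Q => exists2 P,
    left_ideal (fun P' => P' = P1 \/ P' = P2) P & Q = g P) x <->
  exists u v, x = u * g P1 + v * g P2.
Proof.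
move=> gD gM; have gen P : P = P1 \/ P = P2 ->
    exists2 P', left_ideal (fun P' => P' = P1 \/ P' = P2) P' & g P = g P'.
  by move=> h; exists P => //; apply: left_ideal_gen.
split=> [|[u [v ->]]]; last by apply: left_ideal2; apply: gen; [left | right].
apply: (left_ideal_sub (J := fun x => exists u v, x = u * g P1 + v * g P2)).
- by exists 0, 0; rewrite !mul0r addr0.
- by move=> _ _ [u [v ->]] [u' [v' ->]]; exists (u + u'), (v + v');
    rewrite !mulrDl addrACA.
move=> w _ [P /left_ideal_pair[u [v ->]] ->].
by exists (w * g u), (w * g v); rewrite gD !gM mulrDr !mulrA.
Qed.

(** * Commuting operators whose principal parts form a regular sequence *)

(** For forms of degree d this says that f1, f2 is a regular sequence: the only
    syzygies are the multiples of (f2, - f1).  The truncated difference forces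
    c = 0 when n < d. *)
Definition regular_pair (A : comNzRingType) d (f1 f2 : {mpoly A[2]}) :=
  forall n a b, a \is n.-homog -> b \is n.-homog -> a * f1 + b * f2 = 0 ->
  exists2 c, (msize c <= n.+1 - d)%N & a = c * f2 /\ b = - (c * f1).

Section Reduction.
Variables (A : comNzRingType) (D : derivations A) (d : nat).
Variables (P1 P2 : diffop D) (f1 f2 : {mpoly A[2]}).
Hypothesis P1f : principal d P1 f1.
Hypothesis P2f : principal d P2 f2.
Hypothesis P12 : P1 * P2 = P2 * P1.
Hypothesis reg : regular_pair d f1 f2.
Implicit Types (P Q U V : diffop D) (c f : {mpoly A[2]}).

(** One step of the descent in [reduction]: once the principal part of U is a
    multiple c f, the term c P removes it. *)
Lemma cancel_principal N U c P f : principal d P f ->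
  (msize (canform U) <= N.+1 -> msize c <= N.+1 - d ->
   pihomog mdeg N (canform U) = (c * f)%R ->
   msize (canform (U - (c : diffop D) * P)%R) <= N)%N.
Proof.
move=> Pf hU hc e; set C : diffop D := c.
have -> : canform (U - C * P) = (canform U - pihomog mdeg N (canform U))
    + (c * f - canform (C * P)).
  by rewrite e -[canform (_ - _)]/(canform U - canform (C * P)) addrA subrK.
apply: msizeD_leq; first exact: msize_pihomogB.
case: (leqP N.+1 d) => hd.
  move: hc; rewrite (eqP hd) leqn0 msize_poly_eq0 => /eqP c0.
  by rewrite /C c0 !mul0r subrr msize0.
have [k hk] : exists k, (N = k + d)%N by exists (N - d)%N; rewrite subnK.
have hc' : (msize c <= k.+1)%N by move: hc; rewrite hk -addSn addnK.
have [] := principalM (pihomog_principal (hc' : msize (canform C) <= k.+1)%N) Pf.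
rewrite -hk => _ h.
have -> : c * f - canform (C * P) = (c - pihomog mdeg k c) * f -
   (canform (C * P) - pihomog mdeg k (canform C) * f).
  by rewrite mulrBl opprB addrA subrK.
apply: msizeB_leq => //; rewrite mulrC hk addnC.
apply: msizeM_leq; last exact: msize_pihomogB.
by case: Pf => /dhomog_msize_leq.
Qed.

(** If U or V has order at least n, the terms of top degree in U P1 + V P2 must
    cancel, so by regularity the principal parts of U and V are c f2 and
    - c f1.  As P1 and P2 commute, (c P2, - c P1) is a relation between the
    operators, and subtracting it from (U, V) lowers the orders. *)
Theorem reduction n U V :
  (msize (canform (U * P1 + V * P2)%R) <= n + d)%N ->
  exists U' V', [/\ (msize (canform U') <= n)%N, (msize (canform V') <= n)%N
    & U * P1 + V * P2 = U' * P1 + V' * P2].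
Proof.
move=> hQ; have [N] := ubnP (maxn (msize (canform U)) (msize (canform V))).
elim: N => // N IH in U V hQ *; rewrite ltnS => hN.
have [hUV|lt_n] := leqP (maxn (msize (canform U)) (msize (canform V))) n.
  by move: hUV; rewrite geq_max => /andP[? ?]; exists U, V.
have {}lt_n := leq_trans lt_n hN.
case: N => // N in IH hN lt_n *; move: hN; rewrite geq_max => /andP[hU hV].
have Up := pihomog_principal hU; have Vp := pihomog_principal hV.
have := principal_pihomog (principalD (principalM Up P1f) (principalM Vp P2f)).
rewrite pihomog_small; last by rewrite (leq_trans hQ) // leq_add2r.
move=> /esym /(reg (pihomogP _ _ _) (pihomogP _ _ _)) [c hc [eU eV]].
pose C : diffop D := c.
have e : U * P1 + V * P2 = (U - C * P2) * P1 + (V + C * P1) * P2.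
  by rewrite mulrBl mulrDl -!mulrA P12 addrACA addNr addr0.
rewrite e; apply: IH; first by rewrite -e.
rewrite ltnS geq_max (cancel_principal P2f) //=.
have -> : V + C * P1 = V - ((- c) : diffop D) * P1.
  by rewrite -[((- c) : diffop D)]/(- C) mulNr opprK.
by apply: (cancel_principal P1f) => //; rewrite ?mmeasureN // eV mulNr.
Qed.

Corollary small_combination_eq0 U V :
  (msize (canform (U * P1 + V * P2)%R) <= d)%N -> U * P1 + V * P2 = 0.
Proof.
move=> /(reduction (n := 0))[U' [V' []]].
rewrite !leqn0 !msize_poly_eq0 => /eqP U0 /eqP V0 ->.
by rewrite [U']U0 [V']V0 !mul0r addr0.
Qed.

(** With the reduced cofactors no cancellation occurs in the top degree, so the
    leading form is the combination of f1 and f2 by the principal parts of the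
    cofactors.  Thus P1, P2 is a Groebner basis for the filtration by order. *)
Corollary leading_form_combination U V : let Q := U * P1 + V * P2 in
  exists u v, pihomog mdeg (msize (canform Q)).-1 (canform Q) = u * f1 + v * f2.
Proof.
move=> Q; have [le_d|lt_d] := leqP (msize (canform Q)) d.
  by exists 0, 0; rewrite /Q (small_combination_eq0 le_d) raddf0 !mul0r addr0.
have [n hn] : exists n, msize (canform Q) = (n.+1 + d)%N.
  by exists (msize (canform Q) - d).-1; rewrite prednK ?subn_gt0 // subnK // ltnW.
have [U' [V' [hU hV e]]] := reduction (eq_leq hn).
exists (pihomog mdeg n (canform U')), (pihomog mdeg n (canform V')).
rewrite hn addSn /= /Q e; apply: principal_pihomog.
by apply: principalD; apply: principalM => //; apply: pihomog_principal.
Qed.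

End Reduction.

(** * Two cubic forms and their resultant *)

(** With y = x_i xi_i and s = x_1 xi_1 + x_2 xi_2 this is the principal symbol of
    the i-th hypergeometric operator.  It is kept over an arbitrary ring since it
    is used for forms, for their dehomogenizations and for their values. *)
Definition cubic (S : comNzRingType) (x y s : S) : S := y ^+ 3 - x * s ^+ 3.

(** [hg_disc] over an arbitrary ring, so that it applies to polynomials. *)
Definition disc (S : comNzRingType) (x1 x2 : S) : S :=
  (1 - x1 - x2) ^+ 3 - 27%:R * x1 * x2.

Lemma rmorph_cubic (S T : comNzRingType) (f : {rmorphism S -> T}) x y s :
  f (cubic x y s) = cubic (f x) (f y) (f s).
Proof. by rewrite /cubic rmorphB rmorphXn rmorphM rmorphXn. Qed.

Lemma rmorph_disc (S T : comNzRingType) (f : {rmorphism S -> T}) x1 x2 :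
  f (disc x1 x2) = disc (f x1) (f x2).
Proof. by rewrite /disc rmorphB rmorphXn !rmorphB rmorph1 !rmorphM rmorph_nat. Qed.

Section CubicsIdentities.
Variables (S : comNzRingType) (x1 x2 y1 y2 s f1 f2 : S).
Hypotheses (sE : s = y1 + y2) (f1E : f1 = cubic x1 y1 s) (f2E : f2 = cubic x2 y2 s).
Let e := 1 - x1 - x2.

(** Modulo (f1, f2) one has e s^3 = 3 y1 y2 s and y_i^3 = x_i s^3.  Multiplying the
    first relation by y1^2, y2^2 and y1 y2 gives, for u = s^3 y1^2,
    v = s^3 y2^2 and w = s^3 y1 y2, the linear relations
    e u = 3 x1 (v + w), e v = 3 x2 (u + w), e w = 3 (x1 v + x2 u),
    whose determinant is disc.  The three definitions below are the differences
    of the two sides, written as elements of the ideal (f1, f2). *)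
Definition sqr_syzygy := (y1 ^+ 2 + (y2 * s) *+ 3) * f1 + y1 ^+ 2 * f2.
Definition sqr_syzygy' := y2 ^+ 2 * f1 + (y2 ^+ 2 + (y1 * s) *+ 3) * f2.
Definition mixed_syzygy := (y1 * y2 + y2 ^+ 2 *+ 3) * f1 + (y1 * y2 + y1 ^+ 2 *+ 3) * f2.

(** Cramer's rule for the system described at [sqr_syzygy]; likewise for the two
    other unknowns below. *)
Lemma disc_sqr1 : disc x1 x2 * (s ^+ 3 * y1 ^+ 2) =
  (e ^+ 2 - 9%:R * x1 * x2) * sqr_syzygy + (3%:R * x1 * e + 9%:R * x1 ^+ 2) * sqr_syzygy'
   + (3%:R * x1 * e + 9%:R * x1 * x2) * mixed_syzygy.
Proof.
by rewrite /sqr_syzygy /sqr_syzygy' /mixed_syzygy /disc f1E f2E /cubic /e sE; ring.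
Qed.

Lemma disc_sqr2 : disc x1 x2 * (s ^+ 3 * y2 ^+ 2) =
  (3%:R * x2 * e + 9%:R * x2 ^+ 2) * sqr_syzygy + (e ^+ 2 - 9%:R * x1 * x2) * sqr_syzygy'
   + (3%:R * x2 * e + 9%:R * x1 * x2) * mixed_syzygy.
Proof.
by rewrite /sqr_syzygy /sqr_syzygy' /mixed_syzygy /disc f1E f2E /cubic /e sE; ring.
Qed.

(** A power of y2 times a resultant lies in the ideal, as the power 5 = 3 + 3 - 1
    exceeds the top degree 4 of the quotient by two coprime cubics. *)
Lemma disc_pow5 : exists u v, disc x1 x2 * y2 ^+ 5 = u * f1 + v * f2.
Proof.
(* The cofactors come from y2^5 = y2^2 f2 + x2 s^3 y2^2 and [disc_sqr2]. *)
pose c1 := 3%:R * x2 * e + 9%:R * x2 ^+ 2.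
pose c2 := e ^+ 2 - 9%:R * x1 * x2.
pose c3 := 3%:R * x2 * e + 9%:R * x1 * x2.
exists (x2 * (c1 * (y1 ^+ 2 + (y2 * s) *+ 3) + c2 * y2 ^+ 2
  + c3 * (y1 * y2 + y2 ^+ 2 *+ 3))).
exists (disc x1 x2 * y2 ^+ 2 + x2 * (c1 * y1 ^+ 2
  + c2 * (y2 ^+ 2 + (y1 * s) *+ 3) + c3 * (y1 * y2 + y1 ^+ 2 *+ 3))).
have -> : disc x1 x2 * y2 ^+ 5 =
    disc x1 x2 * y2 ^+ 2 * f2 + x2 * (disc x1 x2 * (s ^+ 3 * y2 ^+ 2)).
  by rewrite f2E /cubic; ring.
by rewrite disc_sqr2 /sqr_syzygy /sqr_syzygy' /mixed_syzygy /c1 /c2 /c3; ring.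
Qed.

Lemma disc_mixed : disc x1 x2 * (s ^+ 3 * (y1 * y2)) =
  (9%:R * x1 * x2 + 3%:R * x2 * e) * sqr_syzygy + (3%:R * x1 * e + 9%:R * x1 * x2) * sqr_syzygy'
   + (e ^+ 2 - 9%:R * x1 * x2) * mixed_syzygy.
Proof.
by rewrite /sqr_syzygy /sqr_syzygy' /mixed_syzygy /disc f1E f2E /cubic /e sE; ring.
Qed.

Lemma cube_sum : e * s ^+ 3 = f1 + f2 + (y1 ^+ 2 * y2 + y1 * y2 ^+ 2) *+ 3.
Proof. by rewrite f1E f2E /cubic /e sE; ring. Qed.

(** In degree 4 the relation e s^3 = 3 y1 y2 s gives, for u = s^3 y1 and
    v = s^3 y2, the system e u = 3 x1 v + 3 y1^2 y2^2,
    e v = 3 x2 u + 3 y1^2 y2^2 of determinant e^2 - 9 x1 x2. *)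
Lemma cube_sum1 : (e ^+ 2 - 9%:R * x1 * x2) * (s ^+ 3 * y1) =
   (9%:R * x1 + 3%:R * e) * (y1 ^+ 2 * y2 ^+ 2)
   + 3%:R * x1 * (y2 * f1 + (y2 + y1 *+ 3) * f2)
   + e * ((y1 + y2 *+ 3) * f1 + y1 * f2).
Proof. by rewrite f1E f2E /cubic /e sE; ring. Qed.

Lemma cube_sum2 : (e ^+ 2 - 9%:R * x1 * x2) * (s ^+ 3 * y2) =
   (9%:R * x2 + 3%:R * e) * (y1 ^+ 2 * y2 ^+ 2)
   + 3%:R * x2 * ((y1 + y2 *+ 3) * f1 + y1 * f2)
   + e * (y2 * f1 + (y2 + y1 *+ 3) * f2).
Proof. by rewrite f1E f2E /cubic /e sE; ring. Qed.

End CubicsIdentities.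

(** * Regularity of the pair of cubics in one variable *)

(** Multiplication by r is injective on A / (u). *)
Definition nzd_mod (A : comNzRingType) (u r : A) :=
  forall b c, r * b = u * c -> exists b', b = u * b'.

Section Divisibility.
Variable A : idomainType.
Implicit Types (p q g : {poly A}) (u r : A).

Lemma poly_dvdC u p : (forall i, exists c, p`_i = u * c) -> exists q, p = u%:P * q.
Proof.
elim/poly_ind: p => [|p c IH] H; first by exists 0; rewrite mulr0.
have [i|q ->] := IH.
  by have [b hb] := H i.+1; exists b; rewrite -hb coefD coefMX coefC addr0.
have [b] := H 0; rewrite coefD coefMX coefC add0r => ->.
by exists (q * 'X + b%:P); rewrite mulrDr mulrA polyCM.
Qed.

Lemma nzd_modX u r k b c : u != 0 -> nzd_mod u r ->
  u ^+ k * b = r * c -> exists b', b = r * b'.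
Proof.
move=> u0 H; elim: k => [|k IH] in c *; first by rewrite mul1r => ->; exists c.
rewrite exprS -mulrA => e; have [c' ec] := H _ _ (esym e).
by apply: (IH c'); apply: (mulfI u0); rewrite e ec mulrCA.
Qed.

(** The top coefficient of g p is g_d times that of p; being divisible by r, it
    shows that r divides the leading coefficient of p, which can be removed. *)
Lemma nzd_mod_lead r d g p q :
  (size g <= d.+1)%N -> (forall b c, g`_d * b = r * c -> exists b', b = r * b') ->
  g * p = r%:P * q -> exists p', p = r%:P * p'.
Proof.
move=> sg H; elim: {p}_.+1 {-2}p q (ltnSn (size p)) => [//|[|n] IH] p q; rewrite ltnS => sp e.
  by exists 0; move: sp; rewrite leqn0 size_poly_eq0 => /eqP ->; rewrite mulr0.
have [|b hb] := H p`_n q`_(d + n).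
  have := congr1 (fun p : {poly A} => p`_(d + n)) e; rewrite coefCM => <-.
  have ld : (d < (d + n).+1)%N by rewrite ltnS leq_addr.
  rewrite coefM (bigD1 (Ordinal ld)) //= addKn big1 ?addr0 // => i.
  rewrite -val_eqE /= neq_ltn => /orP[lt|lt]; last first.
    by rewrite (nth_default 0 (leq_trans sg lt)) mul0r.
  by rewrite [p`__]nth_default ?mulr0 // (leq_trans sp) //; lia.
have [||p' hp] := IH (p - r%:P * (b%:P * 'X^n)) (q - g * (b%:P * 'X^n)).
- apply/leq_sizeP => j; rewrite leq_eqVlt => /orP[/eqP<-|lt].
    by rewrite coefB coefCM coefCM coefXn eqxx mulr1 hb subrr.
  rewrite coefB !coefCM coefXn gtn_eqF // !mulr0 subr0.
  by rewrite nth_default // (leq_trans sp).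
- by rewrite !mulrBr e mulrCA.
exists (p' + b%:P * 'X^n); rewrite mulrDr -hp subrK //.
Qed.

End Divisibility.

Section UnivariateRegular.
Variables (A : idomainType) (x1 x2 : A).
Let s : {poly A} := x1%:P * 'X + x2%:P.
Let F1 : {poly A} := cubic x1%:P (x1%:P * 'X) s.
Let F2 : {poly A} := cubic x2%:P x2%:P s.

Let size_s3 : (size (s ^+ 3) <= 4)%N.
Proof.
apply: leq_trans (size_poly_exp_leq _ _) _.
have : (size s <= 2)%N; last lia.
by rewrite /s size_MXaddC; case: ifP => // _; rewrite ltnS size_polyC leq_b1.
Qed.

Let s3_coef3 : (s ^+ 3)`_3 = x1 ^+ 3.
Proof.
have -> : s ^+ 3 = (x1 ^+ 3)%:P * 'X^3 + (3%:R * x1 ^+ 2 * x2)%:P * 'X^2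
   + (3%:R * x1 * x2 ^+ 2)%:P * 'X + (x2 ^+ 3)%:P.
  rewrite /s !(polyCM, rmorphXn, rmorph_nat) /=; ring.
by rewrite !coefD !coefCM !coefXn coefX coefC /= !mulr0 !addr0 mulr1.
Qed.

Lemma cubic2_coef3 : F2`_3 = - (x2 * x1 ^+ 3).
Proof.
by rewrite /F2 /cubic -rmorphXn /= coefB coefC coefCM s3_coef3 sub0r.
Qed.

(** Modulo x2 the polynomial F1 is x1^3 (1 - x1) X^3, so x2 divides a; write
    a = x2 a' and F2 = x2 G2, so that a' F1 = - b G2.  By [disc_pow5] the constant
    r = disc x2^5 is a combination of F1 and F2, hence G2 divides r a'.  The
    leading coefficient of G2 is - x1^3, and x1 can be cancelled modulo r because
    r can be cancelled modulo x1; so G2 divides a' by [nzd_mod_lead]. *)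
Lemma univariate_regular (a b : {poly A}) : x1 != 0 -> x2 != 0 -> disc x1 x2 != 0 ->
    nzd_mod x2 (x1 ^+ 3 * (1 - x1)) -> nzd_mod x1 (disc x1 x2 * x2 ^+ 5) ->
    a * F1 + b * F2 = 0 -> exists c, a = c * F2 /\ b = - (c * F1).
Proof.
move=> x10 x20 disc0 H2 H1 eab.
set r := disc x1 x2 * x2 ^+ 5 in H1.
have r0 : r != 0 by rewrite mulf_neq0 ?expf_neq0.
pose G2 : {poly A} := (x2 ^+ 2)%:P - s ^+ 3.
have F2E : F2 = x2%:P * G2 by rewrite /F2 /cubic /G2 rmorphXn /=; ring.
have F20 : F2 != 0.
  apply: contraTneq (oner_neq0 A) => F20.
  have := cubic2_coef3; rewrite F20 coef0 => /esym/eqP.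
  by rewrite oppr_eq0 mulf_eq0 expf_eq0 (negPf x10) (negPf x20).
have [a' ea] : exists a', a = x2%:P * a'.
  apply: poly_dvdC => i.
  pose H : {poly A} := x1%:P * (3%:R * x1%:P ^+ 2 * 'X^2 + 3%:R * x1%:P * x2%:P * 'X + x2%:P ^+ 2).
  have e : (x1 ^+ 3 * (1 - x1))%:P * (a * 'X^3) = x2%:P * (a * H - b * G2).
    rewrite [RHS]mulrBr [x2%:P * (b * _)]mulrCA -F2E.
    have -> : b * F2 = - (a * F1) by apply/eqP; rewrite -addr_eq0 addrC eab.
    by rewrite /F1 /cubic /H /s polyCM polyCB rmorphXn /=; ring.
  have := congr1 (fun p : {poly A} => p`_(i + 3)) e.
  rewrite !coefCM coefMXn ltnNge leq_addl /= addnK.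
  by move/H2.
have e' : a' * F1 = - (b * G2).
  apply: (@mulfI _ x2%:P); first by rewrite polyC_eq0.
  by apply/eqP; rewrite mulrN -addr_eq0 mulrA -ea mulrCA -F2E eab.
have [u [v euv]] := disc_pow5 (erefl s) (erefl F1) (erefl F2).
have hr : G2 * (v * x2%:P * a' - u * b) = r%:P * a'.
  rewrite /r polyCM rmorphXn -[(disc _ _)%:P]/(polyC _) rmorph_disc /= euv.
  have -> : (u * F1 + v * F2) * a' = u * (a' * F1) + v * F2 * a' by ring.
  by rewrite e' F2E; ring.
have [||c ec] := @nzd_mod_lead A r 3 G2 _ _ _ _ hr.
- rewrite (leq_trans (size_polyD _ _)) // geq_max size_polyN size_s3 andbT.
  by rewrite (leq_trans (size_polyC_leq1 _)).
- move=> b' c; rewrite coefB coefC s3_coef3 sub0r mulNr => h.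
  by apply: (nzd_modX x10 H1 (k := 3) (c := - c)); rewrite mulrN -h opprK.
have ea' : a' = G2 * c.
  by apply: (@mulfI _ r%:P); rewrite ?polyC_eq0 // -hr ec mulrCA.
exists c; have eac : a = c * F2 by rewrite ea ea' F2E; ring.
split=> //; apply: (mulIf F20); apply/eqP.
by rewrite mulNr -mulrA [F1 * F2]mulrC mulrA -eac -addr_eq0 addrC eab.
Qed.

End UnivariateRegular.

(** * Regularity of the pair of cubics in two variables *)

Section Binary.
Variable A : comNzRingType.
Implicit Types (p : {mpoly A[2]}) (q : {poly A}) (m : 'X_{1..2}).

(** Setting xi_2 = 1 identifies the forms of degree n with the polynomials of
    size at most n + 1 in one variable; [homogenize] is the inverse. *)
Definition dehom p : {poly A} := mmap polyC (fun i => if i == i1 then 'X else 1) p.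

HB.instance Definition _ := GRing.RMorphism.copy dehom
  (mmap polyC (fun i => if i == i1 then 'X else 1 : {poly A})).

Definition homogenize n (q : {poly A}) : {mpoly A[2]} :=
  \sum_(j < n.+1) q`_j *: ('X_i1 ^+ j * 'X_i2 ^+ (n - j)).

Lemma dehomC c : dehom c%:MP = c%:P.
Proof. exact: mmapC. Qed.

Lemma dehomX1 : dehom 'X_i1 = 'X.
Proof. by rewrite /dehom mmapX mmap1U. Qed.

Lemma dehomX2 : dehom 'X_i2 = 1.
Proof. by rewrite /dehom mmapX mmap1U. Qed.

Lemma dehomK n p : p \is n.-homog -> homogenize n (dehom p) = p.
Proof.
move=> hp; rewrite [RHS]mpolyE /homogenize {1}(mpolyE p) raddf_sum /=.
under eq_bigr => j _ do rewrite coef_sum scaler_suml.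
rewrite exchange_big /= big_seq [RHS]big_seq; apply: eq_bigr => m pm.
have dm : (m i1 + m i2 = n)%N by rewrite -mdeg2; apply: (dhomog_mf hp).
have lt : (m i1 < n.+1)%N by rewrite ltnS -dm leq_addr.
have e : dehom (p@_m *: 'X_[m]) = p@_m *: 'X^(m i1).
  rewrite -mul_mpolyC rmorphM (mpolyX2 A m) rmorphM !rmorphXn /=.
  by rewrite dehomC dehomX1 dehomX2 expr1n mulr1 mul_polyC.
rewrite e (bigD1 (Ordinal lt)) //= big1 ?addr0 => [|j ne].
  by rewrite coefZ coefXn eqxx mulr1 [in RHS](mpolyX2 A m) /= -[X in (X - _)%N]dm addKn.
rewrite coefZ coefXn; move: ne; rewrite -val_eqE /= => /negPf->.
by rewrite mulr0 scale0r.
Qed.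

Lemma dehom_homogenize n q : dehom (homogenize n q) = \poly_(j < n.+1) q`_j.
Proof.
rewrite poly_def raddf_sum /=; apply: eq_bigr => j _.
rewrite -mul_mpolyC !rmorphM !rmorphXn /= dehomC dehomX1 dehomX2.
by rewrite expr1n mulr1 mul_polyC.
Qed.

Lemma homogenizeK n q : (size q <= n.+1)%N -> dehom (homogenize n q) = q.
Proof.
move=> sq; rewrite dehom_homogenize; apply/polyP => i; rewrite coef_poly.
by case: ltnP => // h; rewrite nth_default // (leq_trans sq).
Qed.

Lemma size_dehom n p : p \is n.-homog -> (size (dehom p) <= n.+1)%N.
Proof. by move=> hp; rewrite -(dehomK hp) dehom_homogenize size_poly. Qed.

Lemma dhomog_homogenize n (q : {poly A}) : homogenize n q \is n.-homog.
Proof.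
apply: rpred_sum => j _; apply: dhomogZ.
have -> : 'X_i1 ^+ j * 'X_i2 ^+ (n - j) = 'X_[mnm2 j (n - j)] :> {mpoly A[2]}.
  by rewrite mpolyXD !mpolyXn.
by rewrite dhomogX /= mdeg2 mnm2_1 mnm2_2 subnKC // -ltnS.
Qed.

Lemma dehom_inj n p p' : p \is n.-homog -> p' \is n.-homog ->
  dehom p = dehom p' -> p = p'.
Proof. by move=> hp hq e; rewrite -(dehomK hp) e dehomK. Qed.

End Binary.

Section SymbolPair.
Variables (A : comNzRingType) (x : 'I_2 -> A).

Definition ysym (i : 'I_2) : {mpoly A[2]} := (x i)%:MP * 'X_i.

Definition hg_symbol (i : 'I_2) : {mpoly A[2]} :=
  cubic (x i)%:MP (ysym i) (ysym i1 + ysym i2).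

Lemma dhomog_ysym i : ysym i \is 1.-homog.
Proof. by apply: (dhomogM (dhomogC _)); rewrite dhomogX /= mdeg1. Qed.

Lemma dhomog_hg_symbol i : hg_symbol i \is 3.-homog.
Proof.
rewrite /hg_symbol /cubic rpredB //; first exact: (dhomogMn 3 (dhomog_ysym i)).
apply: (dhomogM (dhomogC _)); apply: (dhomogMn 3 (d := 1)).
by rewrite rpredD // dhomog_ysym.
Qed.

Lemma rmorph_hg_symbol (T : comNzRingType) (f : {rmorphism {mpoly A[2]} -> T}) i :
  let y j := f (x j)%:MP * f 'X_j in
  f (hg_symbol i) = cubic (f (x i)%:MP) (y i) (y i1 + y i2).
Proof. by rewrite /= rmorph_cubic rmorphD /ysym !rmorphM. Qed.

End SymbolPair.

(** The two conditions on nonzerodivisors hold trivially when A is a field, and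
    when A = C[x_1, x_2] because x_1 and x_2 are primes that do not divide the
    elements in question. *)
Lemma hg_symbol_regular (A : idomainType) (x : 'I_2 -> A) :
  x i1 != 0 -> x i2 != 0 -> disc (x i1) (x i2) != 0 ->
  nzd_mod (x i2) (x i1 ^+ 3 * (1 - x i1)) ->
  nzd_mod (x i1) (disc (x i1) (x i2) * x i2 ^+ 5) ->
  regular_pair 3 (hg_symbol x i1) (hg_symbol x i2).
Proof.
move=> x10 x20 d0 H2 H1 n a b ha hb eab.
have dsym i : dehom (hg_symbol x i) =
    cubic (x i)%:P (dehom (ysym x i)) ((x i1)%:P * 'X + (x i2)%:P).
  rewrite /hg_symbol rmorph_cubic rmorphD /= !dehomC /ysym !rmorphM /= !dehomC.
  by rewrite dehomX1 dehomX2 mulr1.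
have dy1 : dehom (ysym x i1) = (x i1)%:P * 'X.
  by rewrite /ysym rmorphM /= dehomC dehomX1.
have dy2 : dehom (ysym x i2) = (x i2)%:P.
  by rewrite /ysym rmorphM /= dehomC dehomX2 mulr1.
have := congr1 (@dehom A) eab.
rewrite (raddf0 (@dehom A)) (rmorphD (@dehom A)) !(rmorphM (@dehom A)) /=.
rewrite (dsym i1) (dsym i2) dy1 dy2.
case/(univariate_regular x10 x20 d0 H2 H1) => c [ea eb].
have lt3 : (3 < size (dehom (hg_symbol x i2)))%N.
  rewrite ltnNge; apply: contraTN (oner_neq0 A) => /leq_sizeP/(_ 3 (leqnn _)).
  rewrite dsym dy2 cubic2_coef3 => /eqP.
  by rewrite oppr_eq0 mulf_eq0 expf_eq0 (negPf x10) (negPf x20).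
have {}ea : dehom a = c * dehom (hg_symbol x i2) by rewrite ea dsym dy2.
have {}eb : dehom b = - (c * dehom (hg_symbol x i1)) by rewrite eb dsym dy1.
have sc : (size c <= n.+1 - 3)%N.
  have [->|c0] := eqVneq c 0; first by rewrite size_poly0.
  have F20 : dehom (hg_symbol x i2) != 0 by rewrite -size_poly_gt0 (ltn_trans _ lt3).
  have := size_dehom ha; rewrite ea size_mul //; move: lt3.
  by move: (size c) (size (dehom _)) => j k; lia.
have [n3|n3] := ltnP n 3.
  have c0 : c = 0 by apply/eqP; rewrite -size_poly_eq0; lia.
  have a0 : a = 0.
    by apply: (dehom_inj ha); rewrite ?rpred0 // ea c0 mul0r (raddf0 (@dehom A)).
  have b0 : b = 0.
    by apply: (dehom_inj hb); rewrite ?rpred0 // eb c0 mul0r oppr0 (raddf0 (@dehom A)).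
  exists 0; first by rewrite msize0.
  by rewrite a0 b0 (mul0r (hg_symbol x i2)) (mul0r (hg_symbol x i1)) oppr0.
have hn : n = (n - 3 + 3)%N by rewrite subnK.
exists (homogenize (n - 3) c).
  by rewrite subSn //; apply/dhomog_msize_leq/dhomog_homogenize.
have hc i : homogenize (n - 3) c * hg_symbol x i \is n.-homog.
  by rewrite {2}hn dhomogM ?dhomog_homogenize ?dhomog_hg_symbol.
have dc i : dehom (homogenize (n - 3) c * hg_symbol x i) = c * dehom (hg_symbol x i).
  rewrite (rmorphM (@dehom A)) /=; congr (_ * _); apply: homogenizeK.
  by rewrite -subSn.
split; first by apply: (dehom_inj ha); rewrite ?dc.
by apply: (dehom_inj hb); rewrite ?dhomogN // rmorphN /= dc.
Qed.

(** * The hypergeometric operators *)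

Section HypergeometricCommute.
Variables (T : nzRingType) (K : Type) (c : K -> T) (x t : 'I_2 -> T).
Hypothesis cc : forall u v, GRing.comm (c u) (c v).
Hypothesis cx : forall u i, GRing.comm (c u) (x i).
Hypothesis ct : forall u i, GRing.comm (c u) (t i).
Hypothesis xx : forall i j, GRing.comm (x i) (x j).
Hypothesis tt : forall i j, GRing.comm (t i) (t j).
Hypothesis tx : forall i j, t i * x j = x j * (t i + (i == j)%:R).
Variable a : 'I_3 -> K.

Let E z := \prod_(j < 3) (c (a j) + z).

Let E_shift z y z' : (forall u, GRing.comm (c u) y) -> z * y = y * z' ->
  E z * y = y * E z'.
Proof.
move=> cy zy; rewrite /E; elim/big_ind2: _ => [|p q p' q' e e'|j _].
- by rewrite mul1r mulr1.
- by rewrite -mulrA e' mulrA e mulrA.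
- by rewrite mulrDl mulrDr zy cy.
Qed.

Let comm_E y z : (forall u, GRing.comm y (c u)) -> GRing.comm y z ->
  GRing.comm y (E z).
Proof.
move=> cy yz; apply: (big_ind (GRing.comm y)) => [|p q|j _].
- exact: commr1.
- exact: commrM.
- by apply: commrD.
Qed.

Let D b b' i := t i * (c b - 1 + t i) * (c b' - 1 + t i).

Let comm_D y i b b' : (forall u, GRing.comm y (c u)) -> GRing.comm y (t i) ->
  GRing.comm y (D b b' i).
Proof.
move=> yc yt; have f u : GRing.comm y (c u - 1 + t i).
  by apply: commrD yt; apply: commrB; [apply: yc | apply: commr1].
by apply: commrM (f _); apply: commrM (f _).
Qed.

Let ts i : GRing.comm (t i) (t i1 + t i2).
Proof. exact: commrD. Qed.

Let cs u : GRing.comm (c u) (t i1 + t i2).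
Proof. exact: commrD. Qed.

Let sx i : (t i1 + t i2) * x i = x i * (t i1 + t i2 + 1).
Proof.
rewrite mulrDl !tx -mulrDr.
case: (ord2P i) => ->; rewrite eqxx (_ : _ == _ = false) // addr0.
  by rewrite addrAC.
by rewrite addrA.
Qed.

(** The terms of the first operator commute with those of the second, except
    possibly the two products x_i E.  Since E x_i = x_i E' with the same shift E'
    of E for i = 1, 2, both x_1 E x_2 E and x_2 E x_1 E are x_1 x_2 E' E. *)
Theorem hypergeometric_commute b1 b2 b3 b4 :
  GRing.comm (D b1 b2 i1 - x i1 * E (t i1 + t i2))
             (D b3 b4 i2 - x i2 * E (t i1 + t i2)).
Proof.
have DD : GRing.comm (D b1 b2 i1) (D b3 b4 i2).
  apply: comm_D => [u|]; first exact/commr_sym/comm_D.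
  by apply/commr_sym/comm_D => // u; apply/commr_sym.
have tE i : GRing.comm (t i) (E (t i1 + t i2)).
  by apply: comm_E => // u; apply/commr_sym.
have cE u : GRing.comm (c u) (E (t i1 + t i2)) by apply: comm_E.
have DE i b b' : GRing.comm (E (t i1 + t i2)) (D b b' i).
  by apply: comm_D => [u|]; apply/commr_sym.
have Dx i j b b' : i != j -> GRing.comm (x j) (D b b' i).
  move=> /negPf ij; apply: comm_D => [u|]; apply/commr_sym => //.
  by rewrite /GRing.comm tx ij addr0.
have DxE i j b b' : i != j -> GRing.comm (D b b' i) (x j * E (t i1 + t i2)).
  by move=> ij; apply: commrM; apply/commr_sym; [apply: Dx | apply: DE].
apply: commrB; apply/commr_sym; apply: commrB.
- exact/commr_sym.
- exact: DxE.
- exact/commr_sym/DxE.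
have Ex i : E (t i1 + t i2) * x i = x i * E (t i1 + t i2 + 1).
  exact: E_shift.
rewrite /GRing.comm mulrA -[x i2 * _ * _]mulrA Ex [RHS]mulrA -[x i1 * _ * x i2]mulrA Ex.
by rewrite !mulrA xx.
Qed.

End HypergeometricCommute.

Lemma comm_in_alg (S : comNzRingType) (L : lalgType S) (u v : S) :
  GRing.comm (u%:A : L) v%:A.
Proof. by rewrite /GRing.comm -!scalerAl !mul1r !scalerA mulrC. Qed.

Section HGOperators.
Variable C : fieldType.
Implicit Types (i j : 'I_2) (c : C) (a : 'I_3 -> C).
Local Notation x := (xvar C).
Local Notation t := (theta C).
Local Notation W := (weyl C).

Lemma comm_xvar i j : GRing.comm (x i) (x j).
Proof. exact: comm_in_alg. Qed.

Lemma partialE (A : comNzRingType) (D : derivations A) i (Q : diffop D) :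
  partial D i * Q = dlmul D i Q.
Proof.
have -> : partial D i * Q = dlmulm D (U_(i) + 0) Q by rewrite addm0 -dmulX.
by rewrite dlmulmU /dlmulm !mnm0E.
Qed.

Lemma comm_partial i j : GRing.comm (partial (poly_der C) i) (partial _ j).
Proof. by rewrite /GRing.comm !partialE !dlmulX addmC. Qed.

Lemma comm_partial_xvar i j : i != j -> GRing.comm (partial _ i) (x j).
Proof. by move=> /negPf ij; rewrite /GRing.comm partial_xvar ij addr0. Qed.

Lemma comm_wconst_xvar c i : GRing.comm (wconst c) (x i).
Proof. exact: comm_in_alg. Qed.

Lemma comm_wconst_partial c i : GRing.comm (wconst c) (partial _ i).
Proof.
rewrite /GRing.comm /wconst partial_scale mulr1 -scalerAl mul1r.
by rewrite /= mderivC scale0r addr0.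
Qed.

Lemma comm_wconst_theta c i : GRing.comm (wconst c) (t i).
Proof. by apply: commrM; [apply: comm_wconst_xvar | apply: comm_wconst_partial]. Qed.

Lemma comm_wconst c c' : GRing.comm (wconst c) (wconst c' : W).
Proof. exact: comm_in_alg. Qed.

Lemma comm_theta_xvar i j : i != j -> GRing.comm (t i) (x j).
Proof.
move=> ij; apply/commr_sym/commrM; first exact: comm_xvar.
by apply/commr_sym/comm_partial_xvar.
Qed.

Lemma comm_theta i j : GRing.comm (t i) (t j).
Proof.
have [->//|ij] := eqVneq i j.
apply: commrM; first exact: comm_theta_xvar.
apply/commr_sym/commrM; last exact: comm_partial.
by apply: comm_partial_xvar; rewrite eq_sym.
Qed.

End HGOperators.

Section BaseChange.
Variables (A B : comNzRingType) (f : {rmorphism A -> B}).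
Variables (D : derivations A) (D' : derivations B).
Hypothesis fD : forall i c, f (D i c) = D' i (f c).
Local Notation F := (@map_mpoly 2 A B f).

Let map_dlmul i q : F (dlmul D i q) = dlmul D' i (F q).
Proof.
rewrite /dlmul [LHS]raddfD /= [X in X + _]rmorphM /= map_mpolyX; congr (_ + _).
by apply/mpolyP => m; rewrite !mcoeff_map_mpoly /= fD.
Qed.

Lemma map_dmul p q : F (dmul D p q) = dmul D' (F p) (F q).
Proof.
have Fit i n r : F (iter n (dlmul D i) r) = iter n (dlmul D' i) (F r).
  by elim: n => //= n <-; rewrite map_dlmul.
elim/mpolyind: p => [|c m p _ _ IH]; first by rewrite dmul0l !raddf0 dmul0l.
rewrite dmulDl raddfD /= IH raddfD [RHS]dmulDl /= !map_mpolyZ map_mpolyX.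
by rewrite !dmulZl !dmulX /dlmulm map_mpolyZ /= !Fit.
Qed.

Lemma msize_map k q : (msize q <= k -> msize (F q) <= k)%N.
Proof.
by move=> /msizeP hq; apply/msizeP => m hm; rewrite mcoeff_map_mpoly /= hq ?rmorph0.
Qed.

Lemma dhomog_map k p : p \is k.-homog -> F p \is k.-homog.
Proof.
move=> hp; apply/dhomogP => m; rewrite mcoeff_msupp mcoeff_map_mpoly /= => h.
apply: (dhomog_mf hp); rewrite mcoeff_msupp.
by apply: contraNneq h => ->; rewrite rmorph0.
Qed.

End BaseChange.

Section HGSymbol.
Variable C : fieldType.
Implicit Types (i j : 'I_2) (c : C) (a : 'I_3 -> C).
Local Notation R := {mpoly C[2]}.
Local Notation xs := (fun i : 'I_2 => 'X_i : {mpoly C[2]}).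

Lemma theta_xvar i j :
  theta C i * xvar C j = xvar C j * (theta C i + (i == j)%:R).
Proof.
have [->|ij] := eqVneq i j; last by rewrite addr0 (comm_theta_xvar C ij).
by rewrite /theta -mulrA partial_xvar eqxx.
Qed.

Lemma hg_op_comm a b1 b2 b3 b4 :
  hg_op a b1 b2 i1 * hg_op a b3 b4 i2 = hg_op a b3 b4 i2 * hg_op a b1 b2 i1.
Proof.
have H := hypergeometric_commute (@comm_wconst C) (@comm_wconst_xvar C)
  (@comm_wconst_theta C) (@comm_xvar C) (@comm_theta C) theta_xvar a b1 b2 b3 b4.
have e : \prod_(j < 3) (wconst (a j) + theta C i1 + theta C i2) =
   \prod_(j < 3) (wconst (a j) + (theta C i1 + theta C i2)).
  by apply: eq_bigr => j _; rewrite addrA.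
rewrite /hg_op e; exact: H.
Qed.

Lemma principal_theta i : principal 1 (theta C i) (ysym xs i).
Proof. by apply: (principalM (j := 0)); [apply: principal_scale | apply: principal_partial]. Qed.

Lemma principal_lower c i : principal 1 (wconst c - 1 + theta C i) (ysym xs i).
Proof.
rewrite -[ysym _ _]add0r; apply: principalD (principal_theta i).
apply: principal0; apply: (@principal_msize _ _ 0 _ (c%:MP - 1)%:MP).
have -> : wconst c - 1 = (c%:MP - 1)%:A :> weyl C by rewrite scalerBl scale1r.
exact: principal_scale.
Qed.

Lemma principal_hg_op a b b' i : principal 3 (hg_op a b b' i) (hg_symbol xs i).
Proof.
pose s := ysym xs i1 + ysym xs i2.
have -> : hg_symbol xs i = ysym xs i * ysym xs i * ysym xs i
   + - (('X_i)%:MP * s ^+ 3) by rewrite /hg_symbol /cubic -/s; ring.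
apply: principalD.
  by apply: (principalM (j := 2)) (principal_lower _ _);
     apply: (principalM (j := 1)) (principal_theta _) (principal_lower _ _).
apply: principalN; apply: (principalM (j := 0)); first exact: principal_scale.
have f c : principal 1 (wconst c + theta C i1 + theta C i2) s.
  apply: principalD (principal_theta _).
  rewrite -[ysym _ _]add0r; apply: principalD (principal_theta _).
  by apply/principal0/principal_msize/principal_scale.
exact: (@principal_prod _ _ 3 1 _ s (fun l => f (a l))).
Qed.

Lemma weyl_to_ratD : {morph @weyl_to_rat C : P Q / P + Q}.
Proof. by move=> P Q; rewrite /weyl_to_rat; apply: raddfD. Qed.

Lemma weyl_to_ratM : {morph @weyl_to_rat C : P Q / P * Q}.
Proof.
move=> P Q; apply: (map_dmul (D := poly_der C) (D' := rat_der C)).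
by move=> i c; rewrite /= ratder_tofrac.
Qed.

Lemma principal_rat k (P : weyl C) p : principal k P p ->
  principal k (weyl_to_rat P) (map_mpoly (@FracField.tofrac R) p).
Proof.
move=> [hp hP]; split; first exact: dhomog_map.
have -> : canform (weyl_to_rat P) - map_mpoly (@FracField.tofrac R) p =
  map_mpoly (@FracField.tofrac R) (canform P - p) by rewrite rmorphB.
exact: msize_map.
Qed.

End HGSymbol.

(** * Regularity over the polynomial ring and over a field *)

Section PolyRegular.
Variable C : fieldType.
Local Notation R := {mpoly C[2]}.
Local Notation xs := (fun i : 'I_2 => 'X_i : {mpoly C[2]}).

Definition subst0 (i : 'I_2) (p : R) : R :=
  mmap (@mpolyC 2 C) (fun j => if j == i then 0 else 'X_j) p.

HB.instance Definition _ i := GRing.RMorphism.copy (subst0 i)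
  (mmap (@mpolyC 2 C) (fun j => if j == i then 0 else 'X_j : R)).

Lemma subst0X i j : subst0 i 'X_j = if j == i then 0 else 'X_j.
Proof. by rewrite /subst0 mmapX mmap1U. Qed.

(** The kernel of the substitution x_i = 0 is generated by x_i. *)
Lemma subst0_dvd i p : exists q, p = subst0 i p + 'X_i * q.
Proof.
have MQ p1 p2 : (exists q, p1 = subst0 i p1 + 'X_i * q) ->
    (exists q, p2 = subst0 i p2 + 'X_i * q) ->
    exists q, p1 * p2 = subst0 i (p1 * p2) + 'X_i * q.
  rewrite rmorphM /=; move: (subst0 i p1) (subst0 i p2) => s1 s2 [q1 ->] [q2 ->].
  by exists (s1 * q2 + q1 * s2 + 'X_i * (q1 * q2)); ring.
have CQ c : exists q, c%:MP = subst0 i c%:MP + 'X_i * q.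
  by exists 0; rewrite /subst0 mmapC mulr0 addr0.
have XQ j : exists q, 'X_j = subst0 i 'X_j + 'X_i * q.
  rewrite subst0X; case: eqP => [->|_]; last by exists 0; rewrite mulr0 addr0.
  by exists 1; rewrite mulr1 add0r.
have XnQ j n : exists q, 'X_j ^+ n = subst0 i ('X_j ^+ n) + 'X_i * q.
  by elim: n => [|n IH]; [apply: CQ | rewrite exprS; apply: MQ].
elim/mpolyind: p => [|c m p _ _ [q IH]]; first by exists 0; rewrite rmorph0 mulr0 addr0.
have [|q' e] := MQ _ _ (CQ c) (_ : exists q, 'X_[m] = subst0 i 'X_[m] + 'X_i * q).
  by rewrite mpolyX2; apply: MQ.
exists (q' + q); rewrite -mul_mpolyC rmorphD /= {1}IH {1}e; ring.
Qed.

Lemma nzd_mod_var i r : subst0 i r != 0 -> nzd_mod ('X_i : R) r.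
Proof.
move=> r0 b c e; have := congr1 (subst0 i) e.
rewrite !rmorphM /= subst0X eqxx mul0r => /eqP; rewrite mulf_eq0 (negPf r0) /=.
by have [q hq] := subst0_dvd i b => /eqP b0; exists q; rewrite {1}hq b0 add0r.
Qed.

Lemma meval_neq0 (v : 'I_2 -> C) (p : R) : p.@[v] != 0 -> p != 0.
Proof. by apply: contraNneq => ->; rewrite meval0. Qed.

Lemma mpolyXvar_neq0 i : ('X_i : R) != 0.
Proof. by apply: (meval_neq0 (v := fun _ => 1)); rewrite mevalXU oner_eq0. Qed.

Lemma meval_disc v (p q : R) : (disc p q).@[v] = disc p.@[v] q.@[v].
Proof. exact: rmorph_disc. Qed.

Lemma disc_neq0 : disc ('X_i1 : R) 'X_i2 != 0.
Proof.
apply: (meval_neq0 (v := fun _ => 0)); rewrite meval_disc !mevalXU.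
by rewrite /disc !subr0 mulr0 subr0 expr1n oner_eq0.
Qed.

Lemma one_sub_var_neq0 i : 1 - ('X_i : R) != 0.
Proof.
by apply: (meval_neq0 (v := fun _ => 0)); rewrite mevalB meval1 mevalXU subr0 oner_eq0.
Qed.

(** At x_1 = 0 the discriminant becomes (1 - x_2)^3, so it is prime to x_1. *)
Lemma poly_regular : regular_pair 3 (hg_symbol xs i1) (hg_symbol xs i2).
Proof.
apply: hg_symbol_regular; rewrite ?mpolyXvar_neq0 ?disc_neq0 //.
  apply: nzd_mod_var; rewrite rmorphM rmorphXn rmorphB rmorph1 /= subst0X /=.
  by rewrite mulf_neq0 ?expf_neq0 ?mpolyXvar_neq0 ?one_sub_var_neq0.
apply: nzd_mod_var; rewrite rmorphM rmorphXn rmorph_disc /= !subst0X /=.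
rewrite mulf_neq0 ?expf_neq0 ?mpolyXvar_neq0 //.
by rewrite /disc subr0 mulr0 mul0r subr0 expf_neq0 ?one_sub_var_neq0.
Qed.

Lemma field_regular (K : fieldType) (x : 'I_2 -> K) : x i1 != 0 -> x i2 != 0 ->
  disc (x i1) (x i2) != 0 -> regular_pair 3 (hg_symbol x i1) (hg_symbol x i2).
Proof.
move=> x1 x2 d0; have U (u r : K) : u != 0 -> nzd_mod u r.
  by move=> u0 b c _; exists (u^-1 * b); rewrite mulVKf.
by apply: hg_symbol_regular => //; apply: U.
Qed.

End PolyRegular.

(** * The characteristic variety *)

Section CharVariety.
Variable C : fieldType.
Variables (a : 'I_3 -> C) (b1 b2 b3 b4 : C).
Local Notation R := {mpoly C[2]}.
Local Notation xs := (fun i : 'I_2 => 'X_i : {mpoly C[2]}).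
Local Notation I := (hg_ideal a b1 b2 b3 b4).
Let P1 := hg_op a b1 b2 i1.
Let P2 := hg_op a b3 b4 i2.

Definition eval_symbol (x xi : 'I_2 -> C) (f : {mpoly R[2]}) : C :=
  (map_mpoly (meval x) f).@[xi].

HB.instance Definition _ x xi := GRing.RMorphism.copy (eval_symbol x xi)
  (meval xi \o map_mpoly (meval x)).

Lemma eval_hg_symbol x xi i : eval_symbol x xi (hg_symbol xs i) =
  cubic (x i) (x i * xi i) (x i1 * xi i1 + x i2 * xi i2).
Proof.
have eC p : eval_symbol x xi p%:MP = p.@[x].
  by rewrite /eval_symbol map_mpolyC mevalC.
have eX j : eval_symbol x xi 'X_j = xi j.
  by rewrite /eval_symbol map_mpolyX mevalXU.
by rewrite (rmorph_hg_symbol xs (eval_symbol x xi)) /= !eC !eX !mevalXU.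
Qed.

(** This holds for all parameters, since neither the principal parts nor the
    commutation depend on them. *)
Lemma initial_form_hg Q : I Q ->
  exists u v, initial_form Q = u * hg_symbol xs i1 + v * hg_symbol xs i2.
Proof.
move=> /left_ideal_pair[U [V eQ]].
rewrite eQ; exact: (leading_form_combination (principal_hg_op _ _ _ _)
  (principal_hg_op _ _ _ _) (hg_op_comm _ _ _ _ _) (@poly_regular C)).
Qed.

Lemma eval_initial_ideal x xi f :
  eval_symbol x xi (hg_symbol xs i1) = 0 -> eval_symbol x xi (hg_symbol xs i2) = 0 ->
  initial_ideal I f -> eval_symbol x xi f = 0.
Proof.
move=> h1 h2; apply: (left_ideal_sub (J := fun f => eval_symbol x xi f = 0)).
- exact: rmorph0.
- by move=> p q p0 q0; rewrite rmorphD /= p0 q0 addr0.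
move=> u _ [Q /initial_form_hg [v [w ->]] ->].
exact: (@rmorph_combination0 _ _ (eval_symbol x xi) u v w _ _ h1 h2).
Qed.

Lemma hg_symbol_neq0 i : hg_symbol xs i != 0.
Proof.
(* At x = (1, 1) and xi = (1, -1) the sum y_1 + y_2 vanishes, but y_i^3 does not. *)
pose xi j : C := if j == i1 then 1 else -1.
apply: contraTneq (oner_neq0 C) => h.
have := eval_hg_symbol (fun=> 1) xi i; rewrite h rmorph0 /cubic /xi /= !mul1r subrr.
rewrite expr0n subr0 => /esym/eqP; rewrite expf_eq0 /=.
by case: ifP => _; rewrite ?oppr_eq0 => ->.
Qed.

Lemma char_varietyP x xi : char_variety I x xi <->
  forall i, cubic (x i) (x i * xi i) (x i1 * xi i1 + x i2 * xi i2) = 0.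
Proof.
split=> [H i|H f].
  rewrite -eval_hg_symbol; apply: H.
  have IP b b' : I (hg_op a b b' i) -> initial_ideal I (hg_symbol xs i).
    move=> IP; apply: left_ideal_gen; exists (hg_op a b b' i) => //.
    have hP := principal_hg_op a b b' i.
    rewrite /initial_form -(principal_pihomog hP); congr (pihomog _ _ _).
    apply/eqP; rewrite -(eqn_add2r 1) !addn1 prednK ?eqn_leq.
      rewrite (principal_msize hP) andbT ltnNge.
      apply: contraNN (hg_symbol_neq0 i) => /pihomog_small.
      by rewrite (principal_pihomog hP) => ->.
    rewrite lt0n msize_poly_eq0; apply: contraNneq (hg_symbol_neq0 i) => e.
    by rewrite -(principal_pihomog hP) e raddf0.
  by case: (ord2P i) IP => -> IP; [apply: (IP b1 b2) | apply: (IP b3 b4)];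
    apply: left_ideal_gen; [left | right].
by apply: eval_initial_ideal; rewrite eval_hg_symbol.
Qed.

End CharVariety.

(** * The discriminant and the singular locus *)

Lemma prod_cube_roots (F : fieldType) (w u t : F) : w ^+ 2 + w + 1 = 0 ->
  \prod_(k < 3) (u - w ^+ k * t) = u ^+ 3 - t ^+ 3.
Proof.
move=> hw; rewrite !big_ord_recr big_ord0 /= expr0 expr1 !mul1r.
have -> : (u - t) * (u - w * t) * (u - w ^+ 2 * t) = u ^+ 3 - t ^+ 3
   - (w ^+ 2 + w + 1) * (u ^+ 2 * t - u * t ^+ 2 * w) + t ^+ 3 * (1 - w ^+ 3) by ring.
rewrite hw mul0r subr0 (_ : 1 - w ^+ 3 = (1 - w) * (w ^+ 2 + w + 1)); last by ring.
by rewrite hw !mulr0 addr0.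
Qed.

(** By [prod_cube_roots] the inner product is (1 - w^k1 t1)^3 - t2^3. *)
Lemma prod_disc (F : fieldType) (w t1 t2 : F) : w ^+ 2 + w + 1 = 0 ->
  \prod_(k1 < 3) \prod_(k2 < 3) (1 - w ^+ k1 * t1 - w ^+ k2 * t2) =
  disc (t1 ^+ 3) (t2 ^+ 3).
Proof.
move=> hw; under eq_bigr => k _ do rewrite prod_cube_roots //.
rewrite !big_ord_recr big_ord0 /= expr0 expr1 !mul1r /disc.
have w2 : w ^+ 2 = - w - 1.
  by apply/eqP; rewrite -subr_eq0 !opprD !opprK !addrA hw.
ring: w2.
Qed.

Lemma omega_root (F : numClosedFieldType) (w : F) :
  w = (-1 + sqrtC (- 3%:R)) / 2%:R -> w ^+ 2 + w + 1 = 0.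
Proof.
move=> ->; have := sqrtCK (- 3%:R : F); set r := sqrtC _ => r2.
have n2 : (2%:R : F) != 0 by rewrite pnatr_eq0.
by field: r2.
Qed.

(** Some factor 1 - w^k1 t1 - w^k2 t2 of the discriminant vanishes. *)
Lemma disc_eq0_cube_roots (F : numClosedFieldType) (x1 x2 : F) : disc x1 x2 = 0 ->
  exists t1 t2, [/\ t1 ^+ 3 = x1, t2 ^+ 3 = x2 & t1 + t2 = 1].
Proof.
pose w : F := (-1 + sqrtC (- 3%:R)) / 2%:R.
have hw : w ^+ 2 + w + 1 = 0 by apply: omega_root.
have wk k t : (w ^+ k * t) ^+ 3 = t ^+ 3.
  rewrite exprMn exprAC (_ : w ^+ 3 = 1) ?expr1n ?mul1r //.
  apply/eqP; rewrite -subr_eq0 (_ : _ - 1 = (w - 1) * (w ^+ 2 + w + 1)); last by ring.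
  by rewrite hw mulr0.
rewrite -{1}(rootCK (isT : 0 < 3)%N x1) -{1}(rootCK (isT : 0 < 3)%N x2).
rewrite -(prod_disc _ _ hw) => /eqP/prodf_eq0[k1 _ /prodf_eq0[k2 _ /eqP e]].
exists (w ^+ k1 * 3.-root x1), (w ^+ k2 * 3.-root x2); rewrite !wk !rootCK //; split=> //.
by apply/eqP; rewrite eq_sym -subr_eq0 opprD addrA e.
Qed.

(** Put y_i = x_i xi_i and s = y_1 + y_2.  If x_1 x_2 != 0, then s = 0 would force
    xi = 0; so s != 0 and t_i = y_i / s are cube roots of the x_i with sum 1.
    Conversely such roots give the covector xi_i = t_i / x_i. *)
Lemma singular_point_iff (F : numClosedFieldType) (x : 'I_2 -> F) :
  (exists2 xi, forall i, cubic (x i) (x i * xi i) (x i1 * xi i1 + x i2 * xi i2) = 0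
    & ~ (xi i1 = 0 /\ xi i2 = 0)) <->
  x i1 * x i2 * disc (x i1) (x i2) = 0.
Proof.
split=> [[xi H nz]|].
  have [x10|x10] := eqVneq (x i1) 0; first by rewrite x10 !mul0r.
  have [x20|x20] := eqVneq (x i2) 0; first by rewrite x20 mulr0 mul0r.
  set s := x i1 * _ + _ in H.
  have s0 : s != 0.
    apply/negP => /eqP s0; apply: nz; split; apply/eqP.
      by have /eqP := H i1; rewrite s0 /cubic expr0n mulr0 subr0 expf_eq0 mulf_eq0 (negPf x10).
    by have /eqP := H i2; rewrite s0 /cubic expr0n mulr0 subr0 expf_eq0 mulf_eq0 (negPf x20).
  have xE i : x i = (x i * xi i / s) ^+ 3.
    apply: (mulIf (expf_neq0 3 s0)); rewrite -exprMn divfK //.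
    by apply/eqP; rewrite eq_sym -subr_eq0; apply/eqP/H.
  have e2 : x i2 * xi i2 / s = 1 - x i1 * xi i1 / s.
    by apply/eqP; rewrite eq_sym subr_eq addrC -mulrDl -/s divff.
  rewrite [in disc _ _](xE i1) [in disc _ _](xE i2) e2 /disc.
  by set t := _ / s; rewrite (_ : _ - _ = 0) ?mulr0 //; ring.
have [x10 _|x10] := eqVneq (x i1) 0.
  exists (fun i => if i == i1 then 1 else 0); last by case=> /eqP; rewrite oner_eq0.
  by move=> i; case: (ord2P i) => ->;
    rewrite /cubic /= x10 !(mul0r, mulr0, addr0, expr0n, subr0).
have [x20 _|x20] := eqVneq (x i2) 0.
  exists (fun i => if i == i1 then 0 else 1); last by case=> _ /eqP; rewrite oner_eq0.
  by move=> i; case: (ord2P i) => ->;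
    rewrite /cubic /= x20 !(mul0r, mulr0, addr0, expr0n, subr0).
move/eqP; rewrite !mulf_eq0 (negPf x10) (negPf x20) /= => /eqP.
case/disc_eq0_cube_roots => t1 [t2 [h1 h2 h12]].
pose t i := if i == i1 then t1 else t2; pose xi i := t i / x i.
have x_neq0 i : x i != 0 by case: (ord2P i) => ->.
have xxi i : x i * xi i = t i by rewrite mulrC divfK.
exists xi => [i|].
  rewrite !xxi /t /= h12 /cubic expr1n mulr1.
  by case: (ord2P i) => -> /=; rewrite ?h1 ?h2 subrr.
case=> e1 _; move/eqP: x10; apply.
by rewrite -h1 -[t1]/(t i1) -xxi e1 mulr0 expr0n.
Qed.

(** The projection of the characteristic variety outside the zero section is
    already closed. *)
Lemma hg_singular_locus (F : numClosedFieldType) (a : 'I_3 -> F) b1 b2 b3 b4 x :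
  singular_locus (hg_ideal a b1 b2 b3 b4) x <-> x i1 * x i2 * disc (x i1) (x i2) = 0.
Proof.
pose S (x : 'I_2 -> F) := x i1 * x i2 * disc (x i1) (x i2) = 0.
have YS y : (exists2 xi, char_variety (hg_ideal a b1 b2 b3 b4) y xi &
    ~ (xi i1 = 0 /\ xi i2 = 0)) <-> S y.
  rewrite /S -singular_point_iff.
  split=> -[xi H nz]; exists xi; [|exact: nz| |exact: nz].
    exact: (proj1 (char_varietyP _ _ _ _ _ _ _) H).
  exact: (proj2 (char_varietyP _ _ _ _ _ _ _) H).
split=> [H|xS]; last by move=> Z _; apply; apply/YS.
apply: (H S) => [|y]; last by move/YS.
exists (fun f => f = 'X_i1 * 'X_i2 * disc 'X_i1 'X_i2) => y.
have e : ('X_i1 * 'X_i2 * disc 'X_i1 'X_i2 : {mpoly F[2]}).@[y] =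
    y i1 * y i2 * disc (y i1) (y i2) by rewrite !mevalM meval_disc !mevalXU.
by split=> [yS f ->|/(_ _ erefl)]; rewrite e.
Qed.

(** * Reduction of operators to nine monomials *)

Section FormsSpanned.
Variables (K : fieldType) (x1 x2 : K) (N : nat -> {mpoly K[2]} -> Prop).
Variables (y1 y2 s f1 f2 : {mpoly K[2]}).
Hypotheses (sE : s = y1 + y2).
Hypotheses (f1E : f1 = cubic x1%:MP y1 s) (f2E : f2 = cubic x2%:MP y2 s).
Hypotheses (hy1 : y1 \is 1.-homog) (hy2 : y2 \is 1.-homog).
Let e := 1 - x1 - x2.
Hypothesis e_neq0 : e != 0.
Hypothesis e2_neq0 : e ^+ 2 - 9%:R * x1 * x2 != 0.
Hypothesis disc_neq0 : disc x1 x2 != 0.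
Hypothesis ND : forall d p q, N d p -> N d q -> N d (p + q).
Hypothesis NZ : forall d c p, N d p -> N d (c%:MP * p).
Hypothesis Nideal : forall k a b, a \is k.-homog -> b \is k.-homog ->
  N (k + 3) (a * f1 + b * f2).
Hypothesis Nbasis : forall d i j, (i < 3)%N -> (j < 3)%N -> N d (y1 ^+ i * y2 ^+ j).

Implicit Types (c : K) (p q z t : {mpoly K[2]}).

Let NV d c p : c != 0 -> N d (c%:MP * p) -> N d p.
Proof.
move=> c0 /(NZ c^-1); rewrite mulrA -mpolyCM mulVf // mpolyC1.
by rewrite mul1r.
Qed.

Let hs : s \is 1.-homog. Proof. by rewrite sE rpredD. Qed.

Let hX z n : z \is 1.-homog -> z ^+ n \is n.-homog.
Proof. by move=> hz; have := dhomogMn n hz; rewrite mul1n. Qed.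

Let discE : disc x1%:MP x2%:MP = (disc x1 x2)%:MP :> {mpoly K[2]}.
Proof. by rewrite rmorph_disc. Qed.

(** The predicate N d p abstracts that a form p of degree d is congruent, modulo
    (f1, f2), to a combination of the monomials y1^i y2^j with i, j <= 2; only
    its closure properties matter.  The multiples of s^3 are reached by solving
    the linear relations in degrees 3, 4 and 5, whose determinants are e,
    e^2 - 9 x1 x2 and disc; a monomial of degree at least 2 is a multiple of one
    of y1^2, y2^2, y1 y2, which covers all degrees from 5 on. *)
Lemma cubes_spanned i j : N (i + j + 3) (s ^+ 3 * (y1 ^+ i * y2 ^+ j)).
Proof.
pose X1 : {mpoly K[2]} := x1%:MP; pose X2 : {mpoly K[2]} := x2%:MP.
have hsyz k q a b : q \is k.-homog -> a \is 2.-homog -> b \is 2.-homog ->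
    N (k + 2 + 3) (q * (a * f1 + b * f2)).
  by move=> hq ha hb; rewrite mulrDr !mulrA; apply: Nideal; apply: dhomogM.
have yy z t : z \is 1.-homog -> t \is 1.-homog -> z * t \is 2.-homog.
  exact: dhomogM.
have R1 k q : q \is k.-homog -> N (k + 2 + 3) (q * sqr_syzygy y1 y2 s f1 f2).
  by move=> hq; apply: hsyz; rewrite ?rpredD ?rpredMn ?hX ?yy.
have R2 k q : q \is k.-homog -> N (k + 2 + 3) (q * sqr_syzygy' y1 y2 s f1 f2).
  by move=> hq; apply: hsyz; rewrite ?rpredD ?rpredMn ?hX ?yy.
have R3 k q : q \is k.-homog -> N (k + 2 + 3) (q * mixed_syzygy y1 y2 f1 f2).
  by move=> hq; apply: hsyz; rewrite ?rpredD ?rpredMn ?hX ?yy.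
have RC k q c1 c2 c3 m : q \is k.-homog ->
    disc X1 X2 * (s ^+ 3 * m) =
      c1%:MP * sqr_syzygy y1 y2 s f1 f2
      + c2%:MP * sqr_syzygy' y1 y2 s f1 f2
      + c3%:MP * mixed_syzygy y1 y2 f1 f2 ->
    N (k + 2 + 3) (s ^+ 3 * (q * m)).
  move=> hq em; apply: (NV disc_neq0); rewrite -discE.
  have -> : disc X1 X2 * (s ^+ 3 * (q * m)) =
    q * (disc X1 X2 * (s ^+ 3 * m)) by ring.
  have dist (u v w r1 r2 r3 : {mpoly K[2]}) : q * (u * r1 + v * r2 + w * r3) =
    u * (q * r1) + v * (q * r2) + w * (q * r3) by ring.
  rewrite em dist.
  by do 2?apply: ND; apply: NZ; [apply: R1|apply: R2|apply: R3].
have C1 k q : q \is k.-homog -> N (k + 2 + 3) (s ^+ 3 * (q * y1 ^+ 2)).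
  move=> hq; apply: (RC _ _ (e ^+ 2 - 9%:R * x1 * x2)
    (3%:R * x1 * e + 9%:R * x1 ^+ 2) (3%:R * x1 * e + 9%:R * x1 * x2) _ hq).
  by rewrite (disc_sqr1 sE f1E f2E) /e /X1 /X2; ring.
have C2 k q : q \is k.-homog -> N (k + 2 + 3) (s ^+ 3 * (q * y2 ^+ 2)).
  move=> hq; apply: (RC _ _ (3%:R * x2 * e + 9%:R * x2 ^+ 2)
    (e ^+ 2 - 9%:R * x1 * x2) (3%:R * x2 * e + 9%:R * x1 * x2) _ hq).
  by rewrite (disc_sqr2 sE f1E f2E) /e /X1 /X2; ring.
have C3 k q : q \is k.-homog -> N (k + 2 + 3) (s ^+ 3 * (q * (y1 * y2))).
  move=> hq; apply: (RC _ _ (9%:R * x1 * x2 + 3%:R * x2 * e)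
    (3%:R * x1 * e + 9%:R * x1 * x2) (e ^+ 2 - 9%:R * x1 * x2) _ hq).
  by rewrite (disc_mixed sE f1E f2E) /e /X1 /X2; ring.
have hyy a b : y1 ^+ a * y2 ^+ b \is (a + b).-homog by apply: dhomogM; apply: hX.
have [i_ge2|] := leqP 2 i.
  have -> : (i + j = i - 2 + j + 2)%N by rewrite addnAC subnK.
  have -> : y1 ^+ i * y2 ^+ j = y1 ^+ (i - 2) * y2 ^+ j * y1 ^+ 2.
    by rewrite mulrAC -exprD subnK.
  exact: C1.
have [j_ge2 _|] := leqP 2 j.
  have -> : (i + j = i + (j - 2) + 2)%N by rewrite -addnA subnK.
  have -> : y1 ^+ i * y2 ^+ j = y1 ^+ i * y2 ^+ (j - 2) * y2 ^+ 2.
    by rewrite -mulrA -exprD subnK.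
  exact: C2.
case: i j => [|[|//]] [|[|//]] _ _.
- have -> : s ^+ 3 * (y1 ^+ 0 * y2 ^+ 0) = s ^+ 3 by rewrite !expr0 !mulr1.
  apply: (NV e_neq0).
  have -> : e%:MP * s ^+ 3 = (1 * f1 + 1 * f2)
      + (3%:R%:MP * (y1 ^+ 2 * y2 ^+ 1) + 3%:R%:MP * (y1 ^+ 1 * y2 ^+ 2)).
    have := cube_sum sE f1E f2E; rewrite -/X1 -/X2 => h.
    rewrite (_ : e%:MP = 1 - X1 - X2) ?h; last by rewrite /e /X1 /X2; ring.
    by ring.
  by apply: ND; [apply: (Nideal (k := 0)); apply: dhomog1 |
    apply: ND; apply: NZ; apply: Nbasis].
- have -> : y1 ^+ 0 * y2 ^+ 1 = y2 by rewrite mul1r.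
  apply: (NV e2_neq0).
  have -> : (e ^+ 2 - 9%:R * x1 * x2)%:MP * (s ^+ 3 * y2) =
      (9%:R * x2 + 3%:R * e)%:MP * (y1 ^+ 2 * y2 ^+ 2)
      + ((3%:R * x2)%:MP * ((y1 + y2 *+ 3) * f1 + y1 * f2)
         + e%:MP * (y2 * f1 + (y2 + y1 *+ 3) * f2)).
    have h := cube_sum2 sE f1E f2E; rewrite addrA; move: h; rewrite -/X1 -/X2 => h.
    rewrite (_ : (e ^+ 2 - 9%:R * x1 * x2)%:MP = (1 - X1 - X2) ^+ 2 - 9%:R * X1 * X2) ?h.
      by rewrite /e /X1 /X2; ring.
    by rewrite /e /X1 /X2; ring.
  by apply: ND; [|apply: ND]; apply: NZ; [exact: Nbasis | |];
    apply: (Nideal (k := 1)); rewrite ?rpredD ?rpredMn.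
- have -> : y1 ^+ 1 * y2 ^+ 0 = y1 by rewrite mulr1.
  apply: (NV e2_neq0).
  have -> : (e ^+ 2 - 9%:R * x1 * x2)%:MP * (s ^+ 3 * y1) =
      (9%:R * x1 + 3%:R * e)%:MP * (y1 ^+ 2 * y2 ^+ 2)
      + ((3%:R * x1)%:MP * (y2 * f1 + (y2 + y1 *+ 3) * f2)
         + e%:MP * ((y1 + y2 *+ 3) * f1 + y1 * f2)).
    have h := cube_sum1 sE f1E f2E; rewrite addrA; move: h; rewrite -/X1 -/X2 => h.
    rewrite (_ : (e ^+ 2 - 9%:R * x1 * x2)%:MP = (1 - X1 - X2) ^+ 2 - 9%:R * X1 * X2) ?h.
      by rewrite /e /X1 /X2; ring.
    by rewrite /e /X1 /X2; ring.
  by apply: ND; [|apply: ND]; apply: NZ; [exact: Nbasis | |];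
    apply: (Nideal (k := 1)); rewrite ?rpredD ?rpredMn.
- by have := C3 _ _ (hyy 0 0); rewrite !mul1r.
Qed.

(** A monomial divisible by y1^3 is the sum of a multiple of f1 and of
    x1 s^3; likewise for y2^3. *)
Lemma forms_spanned i j : N (i + j) (y1 ^+ i * y2 ^+ j).
Proof.
have [i_lt3|i_ge3] := ltnP i 3; last first.
  have := ND (Nideal (a := y1 ^+ (i - 3) * y2 ^+ j) (b := 0) (k := i - 3 + j) _ _)
    (NZ x1 (cubes_spanned (i - 3) j)).
  rewrite addnAC subnK // mul0r addr0 f1E /cubic => h.
  have -> : y1 ^+ i * y2 ^+ j =
     y1 ^+ (i - 3) * y2 ^+ j * (y1 ^+ 3 - x1%:MP * s ^+ 3) +
      x1%:MP * (s ^+ 3 * (y1 ^+ (i - 3) * y2 ^+ j)).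
    rewrite -{1}(subnK i_ge3) exprD.
    by move: (y1 ^+ (i - 3)) (y2 ^+ j) (s ^+ 3) (y1 ^+ 3) => ? ? ? ?; ring.
  by apply: h; rewrite ?dhomog0 //; apply: dhomogM; apply: hX.
have [j_lt3|j_ge3] := ltnP j 3; first exact: Nbasis.
have := ND (Nideal (b := y1 ^+ i * y2 ^+ (j - 3)) (a := 0) (k := i + (j - 3)) _ _)
    (NZ x2 (cubes_spanned i (j - 3))).
rewrite -addnA subnK // mul0r add0r f2E /cubic => h.
have -> : y1 ^+ i * y2 ^+ j =
   y1 ^+ i * y2 ^+ (j - 3) * (y2 ^+ 3 - x2%:MP * s ^+ 3) +
    x2%:MP * (s ^+ 3 * (y1 ^+ i * y2 ^+ (j - 3))).
  rewrite -{1}(subnK j_ge3) exprD.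
  by move: (y1 ^+ i) (y2 ^+ (j - 3)) (s ^+ 3) (y2 ^+ 3) => ? ? ? ?; ring.
by apply: h; rewrite ?dhomog0 //; apply: dhomogM; apply: hX.
Qed.

End FormsSpanned.

Section Spanning.
Variables (K : fieldType) (D : derivations K) (x : 'I_2 -> K).
Variables (P1 P2 : diffop D).
Let y := ysym x.
Let s := y i1 + y i2.
Let f := hg_symbol x.
Hypothesis P1f : principal 3 P1 (f i1).
Hypothesis P2f : principal 3 P2 (f i2).
Let e := 1 - x i1 - x i2.
Hypothesis x_neq0 : forall i, x i != 0.
Hypothesis e_neq0 : e != 0.
Hypothesis e2_neq0 : e ^+ 2 - 9%:R * x i1 * x i2 != 0.
Hypothesis disc_neq0 : disc (x i1) (x i2) != 0.
Implicit Types (p q : {mpoly K[2]}) (Q : diffop D).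

(** Up to units the monomials d_1^i d_2^j with i, j <= 2 are the y_1^i y_2^j that
    span a complement of (y_1^3, y_2^3), the ideal to which (f1, f2) degenerates
    at x = 0. *)
Definition reduced p := forall m : 'X_{1..2}, (2 < m i1)%N || (2 < m i2)%N -> p@_m = 0.

Definition reducible Q :=
  exists p U V, reduced p /\ Q = (p : diffop D) + (U * P1 + V * P2).

Lemma reducibleD Q Q' : reducible Q -> reducible Q' -> reducible (Q + Q').
Proof.
move=> [p [U [V [hp ->]]]] [p' [U' [V' [hp' ->]]]].
exists (p + p'), (U + U'), (V + V'); split.
  by move=> m hm; rewrite mcoeffD hp ?hp' ?addr0.
rewrite addrACA; congr (_ + _).
by rewrite !mulrDl addrACA.
Qed.

Lemma reducibleZ c Q : reducible Q -> reducible (c *: Q).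
Proof.
move=> [p [U [V [hp ->]]]]; exists (c *: p), (c *: U), (c *: V); split.
  by move=> m hm; rewrite mcoeffZ hp ?mulr0.
by rewrite !scalerDr -!scalerAl.
Qed.

(** The counterpart of [reducible] on principal parts, where the computations with
    the cubic forms take place. *)
Definition reducible_to d p := exists2 Q, reducible Q & (msize (canform Q - p) <= d)%N.

Lemma reducible_toD d p q :
  reducible_to d p -> reducible_to d q -> reducible_to d (p + q).
Proof.
move=> [Q hQ hp] [Q' hQ' hq]; exists (Q + Q'); first exact: reducibleD.
rewrite -[canform _]/(canform Q + canform Q') opprD addrACA.
exact: msizeD_leq.
Qed.

Lemma reducible_toZ d (c : K) p : reducible_to d p -> reducible_to d (c%:MP * p).
Proof.
move=> [Q hQ hp]; exists (c *: Q); first exact: reducibleZ.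
rewrite mul_mpolyC -[canform _]/(c *: canform Q) -scalerBr.
exact: leq_trans (msizeZ_le _ _) hp.
Qed.

Lemma reducible_to_reduced d p : reduced p -> reducible_to d p.
Proof.
move=> hp; exists (p : diffop D); last by rewrite [_ - _]subrr msize0.
by exists p, 0, 0; split=> //; rewrite !mul0r !addr0.
Qed.

Lemma reducible_to_ideal k a b : a \is k.-homog -> b \is k.-homog ->
  reducible_to (k + 3) (a * f i1 + b * f i2).
Proof.
have pr c : c \is k.-homog -> principal k (c : diffop D) c.
  by move=> hc; split=> //; rewrite [_ - _]subrr msize0.
move=> /pr ha /pr hb; exists ((a : diffop D) * P1 + (b : diffop D) * P2).
  exists 0, a, b; split; last by rewrite add0r.
  by move=> m _; rewrite mcoeff0.
by have [] := principalD (principalM ha P1f) (principalM hb P2f).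
Qed.

Let hy i : y i \is 1.-homog := dhomog_ysym x i.
Let hs : s \is 1.-homog. Proof. by rewrite rpredD ?hy. Qed.

Lemma ysym_monomial_coeff i j (m : 'X_{1..2}) :
  (m i1 != i) || (m i2 != j) -> (y i1 ^+ i * y i2 ^+ j)@_m = 0.
Proof.
have -> : y i1 ^+ i * y i2 ^+ j = (x i1 ^+ i * x i2 ^+ j) *: 'X_[mnm2 i j].
  by rewrite -mul_mpolyC mpolyXD -!mpolyXn mpolyCM !rmorphXn /y /ysym /= !exprMn mulrACA.
rewrite mcoeffZ mcoeffX => h; case: eqP => [e0|]; last by rewrite mulr0.
by move: h; rewrite -e0 mnm2_1 mnm2_2 !eqxx.
Qed.

Lemma reducible_to_basis d i j : (i < 3)%N -> (j < 3)%N ->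
  reducible_to d (y i1 ^+ i * y i2 ^+ j).
Proof.
move=> i3 j3; apply: reducible_to_reduced => m hm; apply: ysym_monomial_coeff.
by move: hm; rewrite -negb_and; apply: contraTN => /andP[/eqP-> /eqP->]; lia.
Qed.

Lemma reducible_to_homog n p : p \is n.-homog -> reducible_to n p.
Proof.
move=> hp; rewrite -(dehomK hp) /homogenize.
apply: (big_ind (reducible_to n)) => [|q r|j _].
- by apply: reducible_to_reduced => m _; rewrite mcoeff0.
- exact: reducible_toD.
have j_le : (j <= n)%N by rewrite -ltnS.
have xn0 : x i1 ^+ j * x i2 ^+ (n - j) != 0 by rewrite mulf_neq0 ?expf_neq0.
set c := (dehom p)`_j.
have -> : c *: ('X_i1 ^+ j * 'X_i2 ^+ (n - j)) =
    (c / (x i1 ^+ j * x i2 ^+ (n - j)))%:MP * (y i1 ^+ j * y i2 ^+ (n - j)).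
  rewrite -mul_mpolyC /y /ysym !exprMn mulrACA [RHS]mulrA.
  by rewrite -!rmorphXn -!rmorphM /= divfK.
apply: reducible_toZ; rewrite -{1}(subnKC j_le).
apply: (@forms_spanned _ (x i1) (x i2) reducible_to (y i1) (y i2) s (f i1) (f i2)) => //.
- exact: reducible_toD.
- exact: reducible_toZ.
- exact: reducible_to_ideal.
- exact: reducible_to_basis.
Qed.

(** By induction on the order: the leading form is the principal part of a
    reducible operator, and the difference has smaller order. *)
Lemma all_reducible Q : reducible Q.
Proof.
have [n] := ubnP (msize (canform Q)); elim: n => // n IH in Q *; rewrite ltnS => hQ.
case: n => [|n] in IH hQ *.
  exists 0, 0, 0; split; first by move=> m _; rewrite mcoeff0.
  by rewrite !mul0r !addr0; apply/eqP; rewrite -msize_poly_eq0 -leqn0.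
have [Q' hQ' h] := reducible_to_homog (pihomogP mdeg n (canform Q)).
rewrite -(subrK Q' Q); apply: reducibleD => //; apply: IH; rewrite ltnS.
have -> : canform (Q - Q') = (canform Q - pihomog mdeg n (canform Q))
   - (canform Q' - pihomog mdeg n (canform Q)).
  by rewrite opprB addrA subrK.
by apply: msizeB_leq => //; apply: msize_pihomogB.
Qed.

End Spanning.

(** * Independence of the nine monomials *)

Section UnivariateIndependence.
Variables (K : fieldType) (x1 x2 : K).
Let e := 1 - x1 - x2.
Let F1 : {poly K} := cubic x1%:P 'X ('X + 1).
Let F2 : {poly K} := cubic x2%:P 1 ('X + 1).

Let quartic_eq0 (k0 k1 k2 k3 k4 : K) :
  k0%:P + k1%:P * 'X + k2%:P * 'X^2 + k3%:P * 'X^3 + k4%:P * 'X^4 = 0 :> {poly K} ->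
  [/\ k0 = 0, k1 = 0, k2 = 0, k3 = 0 & k4 = 0].
Proof.
move=> h; have c j := congr1 (fun p : {poly K} => p`_j) h.
by split; [have := c 0 | have := c 1 | have := c 2 | have := c 3 | have := c 4];
  rewrite !coefD !coefCM !coefXn coefX coefC coef0 /= !(mulr0, mulr1, add0r, addr0).
Qed.

(** In the coordinate X = y1 / y2 this says that y1^2 y2^2 is not in the ideal
    (f1, f2).  Comparing coefficients expresses everything by the linear form
    x1 a + x2 b = g1 X + g0, and leaves e g1 = 3 x2 g0 and e g0 = 3 x1 g1. *)
Lemma quartic_independent c a0 a1 b0 b1 : e != 0 -> e ^+ 2 - 9%:R * x1 * x2 != 0 ->
  c%:P * 'X^2 = (a1%:P * 'X + a0%:P) * F1 + (b1%:P * 'X + b0%:P) * F2 -> c = 0.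
Proof.
move=> e0 e20 h; pose g1 := a1 * x1 + b1 * x2; pose g0 := a0 * x1 + b0 * x2.
have [|h0 h1 h2 h3 h4] := @quartic_eq0 (b0 - g0) (b1 - g1 - 3%:R * g0)
   (- 3%:R * (g1 + g0) - c) (a0 - 3%:R * g1 - g0) (a1 - g1).
  transitivity ((a1%:P * 'X + a0%:P) * F1 + (b1%:P * 'X + b0%:P) * F2 - c%:P * 'X^2).
    by rewrite /F1 /F2 /cubic /g1 /g0; ring.
  by rewrite h subrr.
have eg1 : e * g1 = 3%:R * x2 * g0 + x1 * (a1 - g1) + x2 * (b1 - g1 - 3%:R * g0).
  by rewrite /g1 /e; ring.
have eg0 : e * g0 = 3%:R * x1 * g1 + x1 * (a0 - 3%:R * g1 - g0) + x2 * (b0 - g0).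
  by rewrite /g0 /e; ring.
rewrite h1 h4 !mulr0 !addr0 in eg1; rewrite h0 h3 !mulr0 !addr0 in eg0.
have g10 : g1 = 0.
  apply: (mulfI e20); rewrite mulr0.
  have -> : (e ^+ 2 - 9%:R * x1 * x2) * g1 = e * (e * g1) - 3%:R * x2 * (3%:R * x1 * g1).
    by ring.
  by rewrite eg1 -eg0; ring.
have g00 : g0 = 0 by apply: (mulfI e0); rewrite eg0 g10 !mulr0.
by move/eqP: h2; rewrite g10 g00 addr0 mulr0 sub0r oppr_eq0 => /eqP.
Qed.

(** The same comparison in degree 3, where only the constant g = a x1 + b x2
    remains, with e g = 0. *)
Lemma cubic_independent c1 c2 a b : e != 0 ->
  c1%:P * 'X + c2%:P * 'X^2 = a%:P * F1 + b%:P * F2 -> c1 = 0 /\ c2 = 0.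
Proof.
move=> e0 h; pose g := a * x1 + b * x2.
have [|h0 h1 h2 h3 _] := @quartic_eq0 (b - g) (- 3%:R * g - c1) (- 3%:R * g - c2) (a - g) 0.
  transitivity (a%:P * F1 + b%:P * F2 - (c1%:P * 'X + c2%:P * 'X^2)).
    by rewrite /F1 /F2 /cubic /g; ring.
  by rewrite h subrr.
have g0 : g = 0.
  apply: (mulfI e0); rewrite mulr0.
  have -> : e * g = x1 * (a - g) + x2 * (b - g) by rewrite /g /e; ring.
  by rewrite h0 h3 !mulr0 addr0.
move: h1 h2; rewrite g0 mulr0 !sub0r => /eqP + /eqP.
by rewrite !oppr_eq0 => /eqP -> /eqP ->.
Qed.

End UnivariateIndependence.

Section Independence.
Variables (K : fieldType) (D : derivations K) (x : 'I_2 -> K).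
Variables (P1 P2 : diffop D).
Let f := hg_symbol x.
Hypothesis P1f : principal 3 P1 (f i1).
Hypothesis P2f : principal 3 P2 (f i2).
Hypothesis P12 : P1 * P2 = P2 * P1.
Let e := 1 - x i1 - x i2.
Hypothesis x_neq0 : forall i, x i != 0.
Hypothesis e_neq0 : e != 0.
Hypothesis e2_neq0 : e ^+ 2 - 9%:R * x i1 * x i2 != 0.
Hypothesis disc_neq0 : disc (x i1) (x i2) != 0.
Implicit Types (p q : {mpoly K[2]}) (m : 'X_{1..2}).

Let reg : regular_pair 3 (f i1) (f i2).
Proof. exact: field_regular. Qed.

(** Dehomogenization in the coordinates y_i = x_i xi_i, with y_1 = X and y_2 = 1. *)
Let psi p : {poly K} :=
  mmap polyC (fun i => if i == i1 then (x i1)^-1%:P * 'X else (x i2)^-1%:P) p.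

HB.instance Definition _ := GRing.RMorphism.copy psi
  (mmap polyC (fun i => if i == i1 then (x i1)^-1%:P * 'X else (x i2)^-1%:P)).

Let psiC c : psi c%:MP = c%:P. Proof. exact: mmapC. Qed.

Let psiX1 : psi 'X_i1 = (x i1)^-1%:P * 'X.
Proof. by rewrite /psi mmapX mmap1U. Qed.

Let psiX2 : psi 'X_i2 = (x i2)^-1%:P.
Proof. by rewrite /psi mmapX mmap1U. Qed.

Let psi_f1 : psi (f i1) = cubic (x i1)%:P 'X ('X + 1).
Proof.
rewrite (rmorph_hg_symbol x psi) /= !psiC psiX1 psiX2.
by rewrite mulrA -!polyCM !divff // mul1r.
Qed.

Let psi_f2 : psi (f i2) = cubic (x i2)%:P 1 ('X + 1).
Proof.
rewrite (rmorph_hg_symbol x psi) /= !psiC psiX1 psiX2.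
by rewrite mulrA -!polyCM !divff // mul1r.
Qed.

Let psi_combination a b : psi (a * f i1 + b * f i2) =
  psi a * cubic (x i1)%:P 'X ('X + 1) + psi b * cubic (x i2)%:P 1 ('X + 1).
Proof. by rewrite -psi_f1 -psi_f2 -!(rmorphM psi) -(rmorphD psi). Qed.

Let psi_homog0 p : p \is 0.-homog -> exists a, psi p = a%:P.
Proof.
move=> hp; rewrite -(dehomK hp) /homogenize big_ord1 !expr0 mulr1.
by eexists; rewrite -mul_mpolyC mulr1 psiC.
Qed.

Let psi_homog1 p : p \is 1.-homog -> exists a1 a0, psi p = a1%:P * 'X + a0%:P.
Proof.
move=> hp; rewrite -(dehomK hp) /homogenize big_ord_recl big_ord1 /=.
rewrite !expr0 !expr1 mul1r mulr1 -!mul_mpolyC rmorphD !rmorphM /= !psiC psiX1 psiX2.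
by do 2 eexists; rewrite addrC mulrA -!polyCM.
Qed.

Let psi_pihomog n p : psi (pihomog mdeg n p) =
  \sum_(j < n.+1) (p@_(mnm2 j (n - j)) / (x i1 ^+ j * x i2 ^+ (n - j)))%:P * 'X^j.
Proof.
set q := pihomog _ _ _; have hq : q \is n.-homog by apply: pihomogP.
have qE (j : 'I_n.+1) : (dehom q)`_j = p@_(mnm2 j (n - j)).
  have jn : (j <= n)%N by rewrite -ltnS.
  have dm : mdeg (mnm2 j (n - j)) = n by rewrite mdeg2 mnm2_1 mnm2_2 subnKC.
  have := mcoeff_pihomog n p (mnm2 j (n - j)); rewrite -/q dm eqxx => <-.
  rewrite -[X in _ = X@__](dehomK hq); set r := dehom q.
  transitivity (\sum_(i < n.+1) (r`_i *: ('X_i1 ^+ i * 'X_i2 ^+ (n - i)))@_(mnm2 j (n - j)));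
    last by rewrite /homogenize raddf_sum.
  rewrite (bigD1 j) //= big1 ?addr0 => [|i ij].
    by rewrite mcoeffZ !mpolyXn -mpolyXD mcoeffX eqxx mulr1.
  rewrite mcoeffZ !mpolyXn -mpolyXD mcoeffX; case: eqP => [|_]; last by rewrite mulr0.
  move/(congr1 (fun m : 'X_{1..2} => m i1))/eqP.
  by rewrite -/(mnm2 _ _) -/(mnm2 _ _) !mnm2_1 val_eqE (negPf ij).
rewrite -{1}(dehomK hq) /homogenize raddf_sum; apply: eq_bigr => j _ /=.
rewrite -mul_mpolyC !rmorphM !rmorphXn /= psiC psiX1 psiX2 qE.
rewrite exprMn -!rmorphXn /= invfM !exprVn !polyCM.
by rewrite [_ * 'X^j * _]mulrAC !mulrA.
Qed.

(** The reduced monomials of degree at least 3 are the one of degree 4 and the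
    two of degree 3.  By [reduction] the leading form of p is a combination of
    f1 and f2 with cofactors of degree 1, respectively 0, hence zero by the two
    independence lemmas.  So p has order at most 2, less than that of P1 and P2,
    and is zero. *)
Lemma reduced_ideal_eq0 p U V :
  reduced p -> (p : diffop D) = U * P1 + V * P2 -> p = 0.
Proof.
move=> hp ep.
have msize_red k : (forall i j, (i <= 2)%N -> (j <= 2)%N -> (k <= i + j)%N ->
     p@_(mnm2 i j) = 0) -> (msize p <= k)%N.
  move=> H; apply/msizeP => m hm.
  have [|] := boolP ((2 < m i1)%N || (2 < m i2)%N); first exact: hp.
  rewrite negb_or -!leqNgt => /andP[h1 h2]; rewrite -(mnm2E m); apply: H => //.
  by rewrite -mdeg2.
have p0 i j : (2 < i)%N || (2 < j)%N -> p@_(mnm2 i j) = 0.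
  by move=> h; apply: hp; rewrite mnm2_1 mnm2_2.
have top k : (msize p <= k.+1 + 3)%N -> exists a b,
    [/\ a \is k.-homog, b \is k.-homog & pihomog mdeg (k + 3) p = a * f i1 + b * f i2].
  rewrite -[p]/(canform (p : diffop D)) ep.
  move=> /(reduction P1f P2f P12 reg)[U' [V' [hU hV ->]]].
  exists (pihomog mdeg k (canform U')), (pihomog mdeg k (canform V')).
  split; try exact: pihomogP; apply: principal_pihomog.
  by apply: principalD; apply: principalM => //; apply: pihomog_principal.
have divK i j c : c / (x i1 ^+ i * x i2 ^+ j) = 0 -> c = 0.
  move/eqP; rewrite mulf_eq0 invr_eq0 mulf_eq0 !expf_eq0.
  by rewrite !(negPf (x_neq0 _)) !andbF !orbF => /eqP.
have p22 : p@_(mnm2 2 2) = 0.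
  have [|a [b [/psi_homog1[a1 [a0 ea]] /psi_homog1[b1 [b0 eb]] h]]] := top 1.
    by apply: msize_red => i j; lia.
  have := congr1 psi h; rewrite (psi_pihomog _ p) (psi_combination a b) ea eb.
  rewrite !big_ord_recr big_ord0 /= !(p0 0, p0 1, p0 3, p0 4) //.
  rewrite !(mul0r, polyC0, add0r, addr0) => h2.
  exact: (divK 2 2 _ (quartic_independent e_neq0 e2_neq0 h2)).
have [p12 p21] : p@_(mnm2 1 2) = 0 /\ p@_(mnm2 2 1) = 0.
  have [|a [b [/psi_homog0[a0 ea] /psi_homog0[b0 eb] h]]] := top 0.
    apply: msize_red => i j hi hj hij.
    by have [-> ->] : i = 2 /\ j = 2 by lia.
  have := congr1 psi h; rewrite (psi_pihomog _ p) (psi_combination a b) ea eb.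
  rewrite !big_ord_recr big_ord0 /= !(p0 0, p0 3) //.
  rewrite !(mul0r, polyC0, add0r, addr0) expr1 => /(cubic_independent e_neq0)[h1 h2].
  by split; [apply: (divK 1 2) | apply: (divK 2 1)].
rewrite -[LHS]/(canform (p : diffop D)) ep; apply: small_combination_eq0 P1f P2f P12 reg _ _ _.
rewrite -ep; apply: msize_red => i j hi hj hij.
by have [[-> ->]|[[-> ->]|[-> ->]]] :
  (i = 1 /\ j = 2) \/ (i = 2 /\ j = 1) \/ (i = 2 /\ j = 2) by lia.
Qed.

End Independence.

(** * The holonomic rank *)

Section ReducedBasis.
Variable K : fieldType.
Implicit Types (p : {mpoly K[2]}) (c : 'rV[K]_9) (k : 'I_9).

Definition basis_mon k : 'X_{1..2} := mnm2 (k %/ 3) (k %% 3).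

Lemma basis_mon_inj : injective basis_mon.
Proof.
move=> k l e; apply: val_inj; rewrite /= (divn_eq k 3) (divn_eq l 3).
have := congr1 (fun m : 'X_{1..2} => (m i1 * 3 + m i2)%N) e.
by rewrite !mnm2_1 !mnm2_2.
Qed.

Lemma basis_mon_surj (m : 'X_{1..2}) :
  ~~ ((2 < m i1)%N || (2 < m i2)%N) -> exists k, m = basis_mon k.
Proof.
rewrite negb_or -!leqNgt => /andP[h1 h2].
have lt : (m i1 * 3 + m i2 < 9)%N by lia.
exists (Ordinal lt); apply/mnmP => i.
case: (ord2P i) => ->; rewrite ?mnm2_1 ?mnm2_2 /=; lia.
Qed.

Definition basis_comb c : {mpoly K[2]} := \sum_k c 0 k *: 'X_[basis_mon k].

Lemma basis_comb_coeff c k : (basis_comb c)@_(basis_mon k) = c 0 k.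
Proof.
rewrite /basis_comb raddf_sum (bigD1 k) //= big1 => [|l lk].
  by rewrite addr0 mcoeffZ mcoeffX eqxx mulr1.
by rewrite mcoeffZ mcoeffX (inj_eq basis_mon_inj) (negPf lk) mulr0.
Qed.

Lemma reduced_basis_comb c : reduced (basis_comb c).
Proof.
move=> m hm; rewrite /basis_comb raddf_sum big1 //= => k _.
rewrite mcoeffZ mcoeffX; case: eqP => [e|_]; last by rewrite mulr0.
by move: hm; rewrite -e mnm2_1 mnm2_2; case: k {e} => k /= lt9; lia.
Qed.

Lemma reducedP p : reduced p -> p = basis_comb (\row_k p@_(basis_mon k)).
Proof.
move=> hp; apply/mpolyP => m.
have [hm|/basis_mon_surj[k ->]] := boolP ((2 < m i1)%N || (2 < m i2)%N).
  by rewrite hp // reduced_basis_comb.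
by rewrite basis_comb_coeff mxE.
Qed.

End ReducedBasis.

Theorem symbol_pair_quotient_dim (K : fieldType) (D : derivations K) (x : 'I_2 -> K)
    (P1 P2 : diffop D) (J : diffop D -> Prop) :
  principal 3 P1 (hg_symbol x i1) -> principal 3 P2 (hg_symbol x i2) ->
  P1 * P2 = P2 * P1 -> (forall i, x i != 0) -> 1 - x i1 - x i2 != 0 ->
  (1 - x i1 - x i2) ^+ 2 - 9%:R * x i1 * x i2 != 0 -> disc (x i1) (x i2) != 0 ->
  (forall Q, J Q <-> exists U V, Q = U * P1 + V * P2) ->
  quotient_dim J 9.
Proof.
move=> P1f P2f P12 x0 e0 e20 d0 JE.
exists (fun k => 'X_[basis_mon k] : {mpoly K[2]}) => Q.
have [p [U [V [hp eQ]]]] := all_reducible P1f P2f x0 e0 e20 d0 Q.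
have eQp : Q - (p : diffop D) = U * P1 + V * P2 by rewrite eQ addrAC subrr add0r.
exists (\row_k p@_(basis_mon k)); split=> [|c].
  rewrite -[\sum_(k < 9) _]/(basis_comb (\row_k p@_(basis_mon k))) -reducedP //.
  by apply/JE; exists U, V.
rewrite -[\sum_(k < 9) _]/(basis_comb c) => /JE[U' [V' eQc]].
have diff : (p : diffop D) - (basis_comb c : diffop D) = (U' - U) * P1 + (V' - V) * P2.
  rewrite !mulrBl addrACA -opprD -eQc -eQp opprB addrC.
  by rewrite -addrA; congr (_ + _); rewrite addrA addNr add0r.
have hr : reduced (p - basis_comb c).
  by move=> m hm; rewrite mcoeffB hp ?reduced_basis_comb ?subr0.
have := reduced_ideal_eq0 P1f P2f P12 x0 e0 e20 d0 hr diff.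
move/eqP; rewrite subr_eq0 => /eqP ->.
by apply/rowP => k; rewrite mxE basis_comb_coeff.
Qed.

Lemma weyl_to_rat_comm (C : fieldType) (P Q : weyl C) :
  P * Q = Q * P -> weyl_to_rat P * weyl_to_rat Q = weyl_to_rat Q * weyl_to_rat P.
Proof.
move=> e; have pq := weyl_to_ratM P Q; have qp := weyl_to_ratM Q P.
exact: etrans (esym pq) (etrans (congr1 _ e) qp).
Qed.

Section RationalRank.
Variable C : fieldType.
Variables (a : 'I_3 -> C) (b1 b2 b3 b4 : C).
Local Notation R := {mpoly C[2]}.
Local Notation xs := (fun i : 'I_2 => 'X_i : {mpoly C[2]}).
Let x (i : 'I_2) : ratfun C := (@FracField.tofrac R 'X_i).

Let tofrac_neq0 (p : R) : p.@[fun=> 0] != 0 -> @FracField.tofrac R p != 0.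
Proof. by move=> h; rewrite tofrac_eq0 (meval_neq0 h). Qed.

Let map_symbol i : map_mpoly (@FracField.tofrac R) (hg_symbol xs i) = hg_symbol x i.
Proof.
rewrite (rmorph_hg_symbol xs (map_mpoly (@FracField.tofrac R))) /=.
by rewrite !map_mpolyC /= !map_mpolyX.
Qed.

Lemma hg_holonomic_rank : holonomic_rank (hg_ideal a b1 b2 b3 b4) 9.
Proof.
apply: (@symbol_pair_quotient_dim _ _ x (weyl_to_rat (hg_op a b1 b2 i1))
   (weyl_to_rat (hg_op a b3 b4 i2))).
- by rewrite -map_symbol; apply/principal_rat/principal_hg_op.
- by rewrite -map_symbol; apply/principal_rat/principal_hg_op.
- exact: weyl_to_rat_comm (hg_op_comm _ _ _ _ _).
- by move=> i; rewrite tofrac_eq0 mpolyXvar_neq0.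
- rewrite /x -tofrac1 -!tofracB; apply: tofrac_neq0.
  by rewrite !mevalB meval1 !mevalXU !subr0 oner_eq0.
- rewrite (_ : _ - _ = (@FracField.tofrac R ((1 - 'X_i1 - 'X_i2) ^+ 2 - 9%:R * 'X_i1 * 'X_i2))).
    apply: tofrac_neq0; rewrite expr2 !(mevalM, mevalB, meval1, mevalXU).
    by rewrite !mulr0 !subr0 mul1r oner_eq0.
  by rewrite /x; ring.
- rewrite /x -(rmorph_disc (@FracField.tofrac R)) tofrac_eq0; exact: disc_neq0.
by move=> Q; apply: left_ideal_map; [apply: weyl_to_ratD | apply: weyl_to_ratM].
Qed.

End RationalRank.

Theorem theorem2p1 (R : realType) (a : 'I_3 -> R[i]) (b1 b2 b3 b4 : R[i]) :
  let I := hg_ideal a b1 b2 b3 b4 in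
  let omega : R[i] := (-1 + sqrtC (- 3%:R)) / 2%:R in
  [/\ holonomic_rank I 9,
      forall x : 'I_2 -> R[i],
        singular_locus I x <-> x i1 * x i2 * hg_disc (x i1) (x i2) = 0
    & forall x1 x2 t1 t2 : R[i], t1 ^+ 3 = x1 -> t2 ^+ 3 = x2 ->
        \prod_(k1 < 3) \prod_(k2 < 3)
          (1 - omega ^+ k1 * t1 - omega ^+ k2 * t2) = hg_disc x1 x2].
Proof.
move=> I omega; split.
- exact: hg_holonomic_rank.
- exact: hg_singular_locus.
- by move=> x1 x2 t1 t2 <- <-; apply: prod_disc; apply: omega_root.
Qed.
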